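(* Let $\alpha,L>0$, let $g:\mathcal{Z}\to\mathcal{Z}^*$ be a (continuous) monotone operator, and let $\tilde g_z$ be a $(z,L)$-centered stochastic gradient estimator for $g$ for every $z\in\mathcal{Z}$. Let $G,D>0$ be such that $\|g(z)\|_*\le G$ and $\|z-z'\|\le D$ for all $z,z'\in\mathcal{Z}$, and let $\varepsilon>0$. Let $\eta=\frac{\alpha}{8L^2}$, let $T$ be an integer with $T\ge\frac{4}{\eta\alpha}=\frac{32L^2}{\alpha^2}$, and let $N\in\mathbb{N}$ satisfy $$N\ge1+2\log_2\left(\frac{G(G+2LD)}{\alpha\varepsilon}\right).$$ For $w_0\in\mathcal{Z}$ let $\mathcal{O}(w_0)=\hat w_N$ be the output of the restarted stochastic mirror descent algorithm described in the context started at $w_0$. Then $\mathcal{O}$ is an $(\alpha,\varepsilon)$-relaxed proximal oracle for $g$.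
   Context: Setup: $\mathcal{Z}=\mathcal{X}\times\mathcal{Y}$ with $\mathcal{X}\subset\mathbb{R}^n$, $\mathcal{Y}\subset\mathbb{R}^m$ convex and compact; $\|\cdot\|$ is a norm, with dual norm $\|\zeta\|_*=\max_{\|z\|\le1}\langle\zeta,z\rangle$. The distance generating function $r:\mathcal{Z}\to\mathbb{R}$ is $1$-strongly convex: $r(z')\ge r(z)+\langle\nabla r(z),z'-z\rangle+\frac12\|z'-z\|^2$ for all $z,z'\in\mathcal{Z}$ (for non-differentiable $r$, $\langle\nabla r(z),w\rangle:=\sup_{\gamma\in\partial r(z)}\langle\gamma,w\rangle$), and $\max r-\min r$ is finite. The Bregman divergence is $V_z(z')=r(z')-r(z)-\langle\nabla r(z),z'-z\rangle\ge\frac12\|z'-z\|^2$; it satisfies $-\langle\nabla V_z(z'),z'-u\rangle=V_z(u)-V_{z'}(u)-V_z(z')$. $g$ is monotone if $\langle g(z')-g(z),z'-z\rangle\ge0$ for all $z,z'$. A stochastic estimator $\tilde g_{z_0}:\mathcal{Z}\to\mathcal{Z}^*$ is $(z_0,L)$-centered for $g$ if for all $z\in\mathcal{Z}$: (1) $\mathbb{E}[\tilde g_{z_0}(z)]=g(z)$; (2) $\mathbb{E}\|\tilde g_{z_0}(z)-g(z_0)\|_*^2\le L^2\|z-z_0\|^2$. Each evaluation uses fresh randomness, independent of everything before. An $(\alpha,\varepsilon)$-relaxed proximal oracle for $g$ is a (possibly randomized) map $\mathcal{O}:\mathcal{Z}\to\mathcal{Z}$ such that $z'=\mathcal{O}(z)$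 satisfies $\mathbb{E}[\max_{u\in\mathcal{Z}}\{\langle g(z'),z'-u\rangle-\alpha V_z(u)\}]\le\varepsilon$. Algorithm (start $w_0$; parameters $\eta,T,N$): set $\hat w_0=w_0$. For each phase $\nu=1,\dots,N$: draw $\hat T$ uniformly from $\{1,\dots,T\}$ (independently); set $w_0^{(\nu)}=\hat w_{\nu-1}$; for $t=1,\dots,\hat T$ set $$w_t^{(\nu)}=\operatorname*{arg\,min}_{w\in\mathcal{Z}}\Big\{\big\langle\tilde g_{\hat w_{\nu-1}}(w_{t-1}^{(\nu)}),w\big\rangle+\alpha V_{w_0}(w)+\tfrac1\eta V_{w_{t-1}^{(\nu)}}(w)\Big\}$$ (the regularization center $w_0$ is always the original initial point); set $\hat w_\nu=w_{\hat T}^{(\nu)}$. Output $\hat w_N$. *)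

(* Defs.v *)
(* MathComp-Analysis *)
From HB Require Import structures.
From mathcomp Require Export all_boot all_order all_algebra.
From mathcomp Require Export finmap.
From mathcomp Require Export all_classical all_reals all_analysis.
Export Order.TTheory GRing.Theory Num.Theory numFieldNormedType.Exports.

Set Implicit Arguments.
Unset Strict Implicit.
Unset Printing Implicit Defensive.

Local Open Scope classical_set_scope.
Local Open Scope ring_scope.

(* 'rV[R]_k with its Borel sigma-algebra *)
Definition borel_rV (R : realType) (k : nat) :=
  g_sigma_algebraType (@open 'rV[R]_k).

Section VectorSpace.
Context {R : realType} {k : nat}.
Local Notation E := 'rV[R]_k.

Definition pairing (zeta z : E) : R := \sum_i zeta 0 i * z 0 i.

(* An arbitrary norm; it need not be the canonical (max) norm of 'rV[R]_k. *)
Definition is_norm (nrm : E -> R) : Prop :=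
  [/\ forall x y, nrm (x + y) <= nrm x + nrm y,
      forall (a : R) x, nrm (a *: x) = `|a| * nrm x &
      forall x, nrm x = 0 -> x = 0].

Definition dual_norm (nrm : E -> R) (zeta : E) : R :=
  sup [set pairing zeta z | z in [set z | nrm z <= 1]].

Definition is_argmin (Z : set E) (f : E -> \bar R) (w : E) : Prop :=
  Z w /\ forall v, Z v -> (f w <= f v)%E.

Definition monotone_on (Z : set E) (g : E -> E) : Prop :=
  forall z z', Z z -> Z z' -> 0 <= pairing (g z' - g z) (z' - z).

(* Subdifferential of r : Z -> R; functions on Z are total functions whose
   values outside Z are never used. *)
Definition subdiff (Z : set E) (r : E -> R) (z : E) : set E :=
  [set gamma | forall u, Z u -> r z + pairing gamma (u - z) <= r u].

(* <grad r(z), v>, as the supremum over subgradients.  It is only used for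
   v = u - z with u in Z: the subdifferential relative to Z contains the normal
   cone of Z at z, which is invisible in those directions.  It is -oo when r
   has no subgradient at z (e.g. the negative entropy at the relative boundary
   of the simplex). *)
Definition grad_pairing (Z : set E) (r : E -> R) (z v : E) : \bar R :=
  ereal_sup [set (pairing gamma v)%:E | gamma in subdiff Z r z].

(* +oo for every u when r has no subgradient at z *)
Definition bregman (Z : set E) (r : E -> R) (z u : E) : \bar R :=
  ((r u)%:E - (r z)%:E - grad_pairing Z r z (u - z))%E.

Record distance_generating (Z : set E) (nrm : E -> R) (r : E -> R) : Prop := {
  dg_convex : convex_function Z r ;
  (* closedness, which makes min r and the arg min of the mirror steps exist *)
  dg_lsc : lower_semicontinuous
    (fun z => if z \in Z then (r z)%:E else +oo%E) ;
  dg_strongly_convex : forall z z', Z z -> Z z' ->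
    ((r z)%:E + grad_pairing Z r z (z' - z) + (nrm (z' - z) ^+ 2 / 2)%:E
       <= (r z')%:E)%E ;
  dg_bounded : has_ubound (r @` Z) /\ has_lbound (r @` Z) ;
  (* The three-point identity
       - <grad V_z(z'), z' - u> = V_z(u) - V_z'(u) - V_z(z'),
     where grad V_z(z') = grad r(z') - grad r(z), at the points where r has
     subgradients.  It is automatic for differentiable r but can fail under the
     supremum convention, e.g. for r x = |x| + x^2 / 2 on [-1, 1]. *)
  dg_three_point : exists gradr : E -> E, forall z z' u, Z z -> Z z' -> Z u ->
    subdiff Z r z !=set0 -> subdiff Z r z' !=set0 ->
    subdiff Z r z (gradr z) /\
    ((- pairing (gradr z' - gradr z) (z' - u))%:E
       = bregman Z r z u - bregman Z r z' u - bregman Z r z z')%E }.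

End VectorSpace.

Definition setXrow {R : realType} {n m : nat}
    (X : set 'rV[R]_n) (Y : set 'rV[R]_m) : set 'rV[R]_(n + m) :=
  [set row_mx x y | x in X & y in Y].

Section Estimator.
Context {R : realType} {k : nat} {d : measure_display} {Xi : measurableType d}.
Local Notation E := 'rV[R]_k.

(* The random vector \tilde g_{z0}(z) is gt z0 z s, for a random seed s of
   law mu. *)
Definition stochastic_estimator (Z : set E) (gt : E -> E -> Xi -> E) : Prop :=
  measurable_fun
    ((Z `*` Z) `*` setT : set (borel_rV R k * borel_rV R k * Xi)%type)
    ((fun p => gt p.1.1 p.1.2 p.2) :
       borel_rV R k * borel_rV R k * Xi -> borel_rV R k).

Definition centered (mu : probability Xi R) (Z : set E) (nrm : E -> R)
    (g : E -> E) (gt : E -> E -> Xi -> E) (L : R) (z0 : E) : Prop :=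
  forall z, Z z ->
    (forall i : 'I_k, 'E_mu[fun s => (gt z0 z s 0 i)%R] = (g z 0%R i)%:E)%E /\
    ('E_mu[fun s => (dual_norm nrm (gt z0 z s - g z0) ^+ 2)%R]
       <= (L ^+ 2 * nrm (z - z0) ^+ 2)%:E)%E.

End Estimator.

Definition mutually_independent {R : realType} {d : measure_display}
    {Omega : measurableType d} (P : probability Omega R)
    {I : choiceType} (D : set I) (F : I -> set_system Omega) : Prop :=
  forall J : {fset I}, [set` J] `<=` D ->
  forall A : I -> set Omega, (forall i, i \in J -> F i (A i)) ->
    (P (\bigcap_(i in [set` J]) A i) = \prod_(i <- J) P (A i))%E.

Section Algorithm.
Context {R : realType} {k : nat}.
Context {dX : measure_display} {Xi : measurableType dX}.
Context {dO : measure_display} {Omega : measurableType dO}.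
Local Notation E := 'rV[R]_k.

(* xi nu t is the seed of the t-th evaluation of phase nu, and That nu the
   random length of phase nu. *)
Definition fresh_randomness (P : probability Omega R) (mu : probability Xi R)
    (T N : nat) (xi : nat -> nat -> Omega -> Xi) (That : nat -> Omega -> nat)
    : Prop :=
  [/\ forall nu t, (1 <= nu <= N)%N -> (1 <= t <= T)%N ->
        measurable_fun setT (xi nu t) /\
        (forall A, measurable A -> P (xi nu t @^-1` A) = mu A),
      forall nu, (1 <= nu <= N)%N ->
        [/\ measurable_fun setT (That nu),
            forall omega, (1 <= That nu omega <= T)%N &
            forall s, (1 <= s <= T)%N ->
              P (That nu @^-1` [set s]) = (T%:R^-1)%:E] &
      mutually_independent P
        [set i : (nat * nat) + nat |
           match i with
           | inl (nu, t) => (1 <= nu <= N)%N && (1 <= t <= T)%N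
           | inr nu => (1 <= nu <= N)%N
           end]
        (fun i => match i with
           | inl (nu, t) => preimage_set_system setT (xi nu t) measurable
           | inr nu => preimage_set_system setT (That nu) measurable
           end)].

(* what nu and w nu t are \hat w_nu and w_t^(nu).  Nothing is required of
   w nu t omega for t > That nu omega. *)
Definition restarted_mirror_descent (Z : set E) (r : E -> R)
    (gt : E -> E -> Xi -> E) (alpha eta : R) (N : nat)
    (xi : nat -> nat -> Omega -> Xi) (That : nat -> Omega -> nat) (w0 : E)
    (w : nat -> nat -> Omega -> E) (what : nat -> Omega -> E) : Prop :=
  [/\ forall omega, what 0%N omega = w0,
      forall nu omega, (1 <= nu <= N)%N -> w nu 0%N omega = what nu.-1 omega,
      forall nu omega t, (1 <= nu <= N)%N -> (1 <= t <= That nu omega)%N ->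
        is_argmin Z
          (fun v =>
             ((pairing
                 (gt (what nu.-1 omega) (w nu t.-1 omega) (xi nu t omega)) v)%:E
              + alpha%:E * bregman Z r w0 v
              + (eta^-1)%:E * bregman Z r (w nu t.-1 omega) v)%E)
          (w nu t omega),
      forall nu omega, (1 <= nu <= N)%N ->
        what nu omega = w nu (That nu omega) omega &
      forall nu, (nu <= N)%N ->
        measurable_fun setT (what nu : Omega -> borel_rV R k)].

(* A randomized map Z -> Z is a family of Z-valued random vectors. *)
Definition relaxed_proximal_oracle (P : probability Omega R) (Z : set E)
    (r : E -> R) (g : E -> E) (alpha eps : R) (O : E -> Omega -> E) : Prop :=
  forall z, Z z ->
    [/\ measurable_fun setT (O z : Omega -> borel_rV R k),
        forall omega, Z (O z omega) &
        (\int[P]_omega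
           ereal_sup
             [set ((pairing (g (O z omega)) (O z omega - u))%:E
                   - alpha%:E * bregman Z r z u)%E | u in Z]
         <= eps%:E)%E].

End Algorithm.

(* Main.v *)
From HB Require Import structures.
Require Import Defs.
From mathcomp Require Import ring lra measurable_realfun.
Set Implicit Arguments.
Unset Strict Implicit.
Unset Printing Implicit Defensive.
Local Open Scope classical_set_scope.
Local Open Scope ring_scope.

(* Let z be the solution of the variational inequality of g regularised by
   alpha * V_{w0}.  It exists without Brouwer: centeredness makes g Lipschitz,
   so a Euclidean forward-backward step for a small step size is a contraction
   of Z, and a minimiser of its displacement is a fixed point.  Each phase
   halves the expected divergence to z.  Indeed, summing the mirror step
   inequalities over t, the noise costs (alpha / 16) |w_{t-1} - w_0|^2 per step,
   which the terms alpha V_z(w_t) pay for up to a multiple of V_{w_0}(z), while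
   the bias g(w_0) - g(z) telescopes to <g(w_0) - g(z), w_T - z> and is absorbed
   by the last term V_{w_T}(z) / eta.  As V_{w0}(z) <= G^2 / (2 alpha^2) and the
   gap at w is at most (G + L D) |w - z|, about 2 log_2 phases suffice.

   Most of the work is measurability: the iterates depend measurably on the
   seeds because subgradients, once projected on the span of Z - Z, form a
   Borel function.  If r has no subgradient at w0, then V_{w0} = +oo and the
   oracle inequality is trivial. *)

(** * Pairing, norms and dual norms *)

(** A divergence defined by a supremum over subgradients need not be affine in its gradient part.
    The three-point identity forces one subgradient at each point to attain all these suprema, and
    for this selection the usual algebra of divergences is exact. A mirror step then becomes a
    formula: [Q] applied to a dual vector, where [Q] is the gradient of the convex conjugate of [r]
    on [Z], single-valued and continuous by strong convexity. So iterates that are specified as arg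
    mins, and only up to the random length of their phase, extend to all [T] steps as functions of
    the seeds. The extension is independent of the length, which makes the expected divergence after
    a phase a uniform average over [T] steps. The factor 1/2 comes from the constants. As eta L^2 /
    2 = alpha / 16, the noise of a step is at most alpha / 8 times |w_{t-1} - z|^2 + |w_0 - z|^2,
    with w_0 the start of the phase: the first part is paid by the previous step, the second is at
    most (alpha / 4) V_{w_0}(z). As T >= 4 / (eta alpha), the initial V_{w_0}(z) / eta is at most
    (alpha T / 4) V_{w_0}(z). Together this is half of alpha T V_{w_0}(z). *)

Section Pairing.
Context {R : realType} {k : nat}.
Local Notation E := 'rV[R]_k.
Implicit Types x y z : E.

Lemma pairingC x y : pairing x y = pairing y x.
Proof. by apply: eq_bigr => i _; rewrite mulrC. Qed.

Lemma pairingDr x y z : pairing x (y + z) = pairing x y + pairing x z.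
Proof. by rewrite -big_split; apply: eq_bigr => i _; rewrite mxE mulrDr. Qed.

Lemma pairingZr (a : R) x y : pairing x (a *: y) = a * pairing x y.
Proof. by rewrite mulr_sumr; apply: eq_bigr => i _; rewrite mxE mulrCA. Qed.

Lemma pairingNr x y : pairing x (- y) = - pairing x y.
Proof. by rewrite -scaleN1r pairingZr mulN1r. Qed.

Lemma pairingBr x y z : pairing x (y - z) = pairing x y - pairing x z.
Proof. by rewrite pairingDr pairingNr. Qed.

Lemma pairingDl x y z : pairing (x + y) z = pairing x z + pairing y z.
Proof. by rewrite pairingC pairingDr !(pairingC z). Qed.

Lemma pairingZl (a : R) x y : pairing (a *: x) y = a * pairing x y.
Proof. by rewrite pairingC pairingZr pairingC. Qed.

Lemma pairingNl x y : pairing (- x) y = - pairing x y.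
Proof. by rewrite pairingC pairingNr pairingC. Qed.

Lemma pairingBl x y z : pairing (x - y) z = pairing x z - pairing y z.
Proof. by rewrite pairingDl pairingNl. Qed.

Definition pairingE := (pairingDr, pairingDl, pairingNr, pairingNl,
  pairingZr, pairingZl).

Lemma pairing0r x : pairing x 0 = 0.
Proof. by rewrite -(scale0r 0) pairingZr mul0r. Qed.

Lemma pairing_ge0 x : 0 <= pairing x x.
Proof. by apply: sumr_ge0 => i _; rewrite -expr2 sqr_ge0. Qed.

Lemma pairing_eq0 x : pairing x x = 0 -> x = 0.
Proof.
move=> /eqP; rewrite psumr_eq0; last by move=> i _; rewrite -expr2 sqr_ge0.
move=> /allP h; apply/rowP => i; rewrite mxE.
by have := h i (mem_index_enum _); rewrite -expr2 sqrf_eq0 => /eqP.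
Qed.

Lemma coord_le_norm x i : `|x 0 i| <= `|x|.
Proof.
by rewrite [leRHS]mx_normrE; apply: (le_bigmax _ (fun ij => `|x ij.1 ij.2|) (0, i)).
Qed.

Lemma sqr_norm_le_pairing x : `|x| ^+ 2 <= pairing x x.
Proof.
have [->|] := eqVneq `|x| 0; first by rewrite expr0n/= pairing_ge0.
move=> /(@mx_norm_neq0 R 1 k x)[[i j]] /= xE; rewrite -[ `|x| ]/(mx_norm x) xE.
rewrite (ord1 i) -normrX ger0_norm ?sqr_ge0//.
rewrite /pairing (bigD1 j)//= -expr2 lerDl.
by apply: sumr_ge0 => l _; rewrite -expr2 sqr_ge0.
Qed.

Lemma pairing_le_norm x y : `|pairing x y| <= k%:R * (`|x| * `|y|).
Proof.
apply: (le_trans (ler_norm_sum _ _ _)).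
rewrite mulr_natl -[X in _ *+ X]card_ord -sumr_const.
by apply: ler_sum => i _; rewrite normrM ler_pM ?coord_le_norm.
Qed.

Lemma pairing_continuous {T : topologicalType} (f h : T -> E) (t : T) :
  {for t, continuous f} -> {for t, continuous h} ->
  {for t, continuous (fun s => pairing (f s) (h s))}.
Proof.
move=> cf ch; rewrite /pairing; apply: cvg_big => [|i _].
  exact: add_continuous.
have cc (h' : T -> E) : {for t, continuous h'} ->
    {for t, continuous (fun s => h' s 0 i)}.
  move=> ch'; exact: (@continuous_comp _ _ _ h' (fun M : E => M 0 i) t ch'
    (@coord_continuous R 1 k 0 i (h' t))).
by apply: cvgM; exact: cc.
Qed.

End Pairing.

Section Norm.
Context {R : realType} {k : nat}.
Local Notation E := 'rV[R]_k.
Variables (nrm : E -> R) (nrmP : is_norm nrm).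

Lemma nrmD x y : nrm (x + y) <= nrm x + nrm y.
Proof. by case: nrmP. Qed.

Lemma nrmZ (a : R) x : nrm (a *: x) = `|a| * nrm x.
Proof. by case: nrmP. Qed.

Lemma nrm0 : nrm 0 = 0.
Proof. by rewrite -(scale0r 0) nrmZ normr0 mul0r. Qed.

Lemma nrmN x : nrm (- x) = nrm x.
Proof. by rewrite -scaleN1r nrmZ normrN1 mul1r. Qed.

Lemma nrm_distC x y : nrm (x - y) = nrm (y - x).
Proof. by rewrite -nrmN opprB. Qed.

Lemma nrm_ge0 x : 0 <= nrm x.
Proof. by have := nrmD x (- x); rewrite subrr nrm0 nrmN; lra. Qed.

Lemma nrm_gt0 x : x != 0 -> 0 < nrm x.
Proof.
move=> x0; rewrite lt_neqAle nrm_ge0 andbT eq_sym; apply: contra x0 => /eqP.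
by case: nrmP => _ _ h /h ->.
Qed.

Lemma nrm_le_norm : exists2 C, 0 < C & forall x, nrm x <= C * `|x|.
Proof.
exists (1 + \sum_(i < k) nrm (delta_mx 0 i)).
  by apply: ltr_pwDl => //; apply: sumr_ge0 => i _; exact: nrm_ge0.
move=> x; apply: (@le_trans _ _ (\sum_(i < k) nrm (delta_mx 0 i) * `|x|)); last first.
  by rewrite -mulr_suml ler_wpM2r// lerDr.
rewrite [in leLHS](row_sum_delta x).
elim/big_ind2 : _ => [|u a v b ua vb|i _]; first by rewrite nrm0.
  exact: (le_trans (nrmD _ _) (lerD ua vb)).
by rewrite nrmZ mulrC ler_wpM2l ?nrm_ge0// coord_le_norm.
Qed.

Lemma rV_lipschitz_continuous {f : E -> R} C :
  (forall x y, f x - f y <= C * `|x - y|) -> continuous f.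
Proof.
move=> fC x; apply/(@cvgrPdist_le _ R^o _ (nbhs x)) => e e0.
have e'0 : 0 < e / (`|C| + 1) by rewrite divr_gt0// ltr_wpDl.
apply/nbhs_ballP; exists (e / (`|C| + 1)) => // y.
rewrite mx_norm_ball => /ltW xy.
have Cd z t : `|z - t| <= e / (`|C| + 1) -> C * `|z - t| <= e.
  rewrite ler_pdivlMr ?ltr_wpDl// => h; apply: le_trans h.
  rewrite mulrC ler_wpM2l//; apply: (le_trans (ler_norm _)); rewrite lerDl//.
rewrite ler_norml; apply/andP; split.
  by rewrite lerNl opprB (le_trans (fC _ _))// Cd// distrC.
by rewrite (le_trans (fC _ _))// Cd.
Qed.

Lemma nrm_continuous : continuous nrm.
Proof.
have [C C0 nC] := nrm_le_norm; apply: (@rV_lipschitz_continuous _ C) => x y.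
by rewrite (le_trans _ (nC _))// lerBlDr (le_trans _ (nrmD _ _))// subrK.
Qed.

Lemma nrm2_le_pairing :
  exists2 c, 0 < c & forall x, nrm x ^+ 2 <= c * pairing x x.
Proof.
have [C C0 nC] := nrm_le_norm; exists (C ^+ 2); first exact: exprn_gt0.
move=> x; rewrite (@le_trans _ _ ((C * `|x|) ^+ 2))//.
  by rewrite lerXn2r// nnegrE ?nrm_ge0// mulr_ge0// ltW.
by rewrite exprMn ler_wpM2l ?sqr_ge0// sqr_norm_le_pairing.
Qed.

(** A continuous function that vanishes only at 0 has a positive minimum on the compact Euclidean
    unit sphere; [m] is the square of that minimum, and homogeneity does the rest. *)
Lemma pairing_le_nrm2 :
  exists2 m, 0 < m & forall x, m * pairing x x <= nrm x ^+ 2.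
Proof.
pose S := [set x : E | pairing x x = 1].
have pc : continuous (fun x : E => pairing x x).
  by move=> x; apply: pairing_continuous => //; exact: cvg_id.
have cS : compact S.
  apply: bounded_closed_compact.
    exists 1; split=> // M M1 x /= Sx; rewrite (le_trans _ (ltW M1))//.
    rewrite -(@ler_pXn2r _ 2)// ?nnegrE// expr1n -Sx.
    exact: sqr_norm_le_pairing.
  rewrite (_ : S = (fun x : E => pairing x x) @^-1` [set 1])//.
  by apply: preimage_closed; [move=> x _; exact: pc|exact: closed_eq].
(* An empty sphere means that every vector is 0, as for [k = 0]. *)
have [S0|] := pselect (S !=set0); last first.
  move=> S0; exists 1 => // x; have [->|x0] := eqVneq x 0.
    by rewrite pairing0r mulr0 sqr_ge0.
  exfalso; apply: S0; exists ((Num.sqrt (pairing x x))^-1 *: x) => /=.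
  have p0 : 0 < pairing x x.
    rewrite lt_neqAle pairing_ge0 andbT eq_sym.
    by apply: contra x0 => /eqP/pairing_eq0 ->.
  rewrite /S/= !pairingE mulrA -invfM -expr2 sqr_sqrtr ?pairing_ge0//.
  by rewrite mulVf// gt_eqF.
have [|c cS' cmin] := @EVT_min_rV R k nrm S S0 cS.
  by apply: continuous_subspaceT; exact: nrm_continuous.
have {}cS' : S c by rewrite inE in cS'.
have c0 : c != 0.
  by apply/eqP => c0; move: cS'; rewrite /S/= c0 pairing0r; lra.
exists (nrm c ^+ 2); first by rewrite exprn_gt0// nrm_gt0.
move=> x; have [->|x0] := eqVneq x 0.
  by rewrite pairing0r mulr0 sqr_ge0.
have p0 : 0 < pairing x x.
  rewrite lt_neqAle pairing_ge0 andbT eq_sym.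
  by apply: contra x0 => /eqP/pairing_eq0 ->.
have s0 : 0 < Num.sqrt (pairing x x) by rewrite sqrtr_gt0.
have Sy : ((Num.sqrt (pairing x x))^-1 *: x) \in S.
  rewrite inE /S/= !pairingE mulrA -invfM -expr2 sqr_sqrtr ?pairing_ge0//.
  by rewrite mulVf// gt_eqF.
have := cmin _ Sy; rewrite nrmZ gtr0_norm ?invr_gt0// mulrC ler_pdivlMr// => h.
rewrite -[X in _ * X](sqr_sqrtr (pairing_ge0 x)) -exprMn lerXn2r// nnegrE ?nrm_ge0//.
by rewrite mulr_ge0 ?nrm_ge0// ltW.
Qed.

Local Notation dual := (dual_norm nrm).

Let dual_set (zeta : E) := [set pairing zeta z | z in [set z | nrm z <= 1]].

(** The supremum in [dual_norm] is a real one, so boundedness must come first. On the unit ball of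
    [nrm], [pairing z z <= m^-1], and expanding the square of [zeta - z] bounds the pairing. *)
Lemma dual_has_sup zeta : has_sup (dual_set zeta).
Proof.
split; first by exists (pairing zeta 0), 0 => //=; rewrite nrm0.
have [m m0 hm] := pairing_le_nrm2.
exists (pairing zeta zeta + m^-1) => _ [z /= z1 <-].
have zm : pairing z z <= m^-1.
  rewrite -div1r ler_pdivlMr// mulrC (le_trans (hm z))//.
  by rewrite expr_le1// nrm_ge0.
have := pairing_ge0 (zeta - z); have := pairing_ge0 zeta; have := pairing_ge0 z.
by rewrite !pairingE (pairingC z); lra.
Qed.

Lemma dual_ge0 zeta : 0 <= dual zeta.
Proof.
apply: sup_upper_bound; first exact: dual_has_sup.
by exists 0 => /=; rewrite ?nrm0// pairing0r.
Qed.

Lemma pairing_le_dual zeta z : pairing zeta z <= dual zeta * nrm z.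
Proof.
have [->|z0] := eqVneq z 0; first by rewrite pairing0r nrm0 mulr0.
have n0 := nrm_gt0 z0; rewrite -ler_pdivrMr// mulrC -pairingZr.
apply: sup_upper_bound; first exact: dual_has_sup.
exists ((nrm z)^-1 *: z) => //=.
by rewrite nrmZ gtr0_norm ?invr_gt0// mulVf// gt_eqF.
Qed.

Lemma normr_pairing_le (x v : E) : `|pairing x v| <= dual x * nrm v.
Proof.
rewrite ler_norml pairing_le_dual// andbT lerNl -pairingNr.
by rewrite -(nrmN v) pairing_le_dual.
Qed.

Lemma dual_le zeta M : (forall z, nrm z <= 1 -> pairing zeta z <= M) ->
  dual zeta <= M.
Proof.
move=> h; apply: ge_sup; first exact: (dual_has_sup zeta).1.
by move=> _ [z /= z1 <-]; exact: h.
Qed.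

Lemma dual_continuous : continuous (dual : E -> R).
Proof.
have [m m0 hm] := pairing_le_nrm2.
pose C := Num.sqrt m^-1.
have zC z : nrm z <= 1 -> `|z| <= C.
  move=> z1; rewrite -(@ler_pXn2r _ 2)// ?nnegrE// ?sqrtr_ge0//.
  rewrite sqr_sqrtr ?invr_ge0 ?(ltW m0)// (le_trans (sqr_norm_le_pairing _))//.
  rewrite -div1r ler_pdivlMr// mulrC (le_trans (hm z))//.
  by rewrite expr_le1// nrm_ge0.
apply: (@rV_lipschitz_continuous _ (k%:R * C)) => x y.
rewrite lerBlDr; apply: dual_le => z z1.
rewrite -[x](subrK y) pairingDl addrK lerD//.
  apply: (le_trans (ler_norm _)); apply: (le_trans (pairing_le_norm _ _)).
  by rewrite -mulrA ler_wpM2l// mulrC ler_wpM2r// zC.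
rewrite (le_trans (pairing_le_dual _ _))// ler_piMr// dual_ge0//.
Qed.

(** Test the dual norm on [zeta] itself, square, and divide by [pairing zeta zeta]. *)
Lemma pairing_le_dual_sqr c zeta : 0 <= c ->
  (forall x, nrm x ^+ 2 <= c * pairing x x) -> pairing zeta zeta <= c * dual zeta ^+ 2.
Proof.
move=> c0 hc; have [->|z0] := eqVneq (pairing zeta zeta) 0.
  by rewrite mulr_ge0 ?sqr_ge0.
have p0 : 0 < pairing zeta zeta by rewrite lt_neqAle eq_sym z0 pairing_ge0.
rewrite -(ler_pM2r p0) -expr2 mulrAC.
apply: (@le_trans _ _ ((dual zeta * nrm zeta) ^+ 2)).
  rewrite lerXn2r// ?nnegrE ?pairing_ge0// ?pairing_le_dual//.
  by rewrite mulr_ge0 ?dual_ge0 ?nrm_ge0.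
by rewrite exprMn mulrC ler_wpM2r ?sqr_ge0.
Qed.

End Norm.

(** * Minimisers and subgradients *)

(** Lower semicontinuity relative to [Z], kept real-valued: the values of [f] off [Z] are
    arbitrary. *)
Definition lsc_on {T : topologicalType} {R : realType} (Z : set T) (f : T -> R) :=
  forall x a, Z x -> a < f x -> \forall y \near x, Z y -> a < f y.

(** Compactness is used twice: for a lower bound, and then, supposing that the infimum is not
    attained, for a single level above the infimum that [f] exceeds on all of [Z], which is
    absurd. *)
Lemma lsc_on_min {T : topologicalType} {R : realType} (Z : set T) (f : T -> R) :
  compact Z -> Z !=set0 -> lsc_on Z f ->
  exists2 x, Z x & forall y, Z y -> f x <= f y.
Proof.
move=> cZ [z0 Zz0] lf; apply: contrapT => nomin.
have lt_ex x : Z x -> exists2 y, Z y & f y < f x.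
  move=> Zx; apply: contrapT => h; apply: nomin; exists x => // y Zy.
  by rewrite leNgt; apply/negP => yx; apply: h; exists y.
pose L := [set f x | x in Z].
have bL : has_lbound L.
  have /near_covering_withinP := (compact_near_coveringP Z).1 cZ.
  move=> /(_ R -oo (fun c x => c < f x) _) [].
    move=> x Zx; have [V /= Vx] : exists2 V, nbhs x V & forall y, V y -> Z y -> f x - 1 < f y.
      by exists [set y | Z y -> f x - 1 < f y] => //; apply: lf => //; lra.
    move=> Vf; exists (V, [set c | c < f x - 1]) => /=.
      by split => //; exists (f x - 1); split => //; rewrite num_real.
    by move=> [y c] [/= Vy cx] Zy; exact: lt_trans cx (Vf _ Vy Zy).
  move=> M [Mr h]; exists (M - 1) => _ [x Zx <-].
  by apply/ltW; apply: (h (M - 1)) => //; lra.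
have iL : has_inf L by split => //; exists (f z0), z0.
have inf_lt x : Z x -> inf L < f x.
  move=> Zx; have [y Zy yx] := lt_ex x Zx.
  by apply: le_lt_trans yx; apply: inf_lbound => //; exists y.
have : \forall c \near (inf L)^'+, Z `<=` (fun x => c < f x).
  have /near_covering_withinP := (compact_near_coveringP Z).1 cZ; apply.
  move=> x Zx; pose a := (inf L + f x) / 2.
  have La : inf L < a by have := inf_lt _ Zx; rewrite /a; lra.
  exists ([set y | Z y -> a < f y], [set c | c < a]) => /=.
    split; first by apply: lf => //; have := inf_lt _ Zx; rewrite /a; lra.
    exact: nbhs_right_lt.
  by move=> [y c] [/= Vy cx] Zy; exact: lt_trans cx (Vy Zy).
move=> h.
have [c [hc Lc]] : exists c, Z `<=` (fun x => c < f x) /\ inf L < c.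
  near ((inf L)^'+) => c; exists c; split; near: c => //.
  exact: nbhs_right_gt.
have cL : 0 < c - inf L by rewrite subr_gt0.
have [_ [x Zx <-]] := inf_adherent cL iL.
rewrite addrC subrK => /lt_trans/(_ (hc _ Zx)).
by rewrite ltxx.
Unshelve. all: by end_near. Qed.

Section Subgradients.
Context {R : realType} {k : nat}.
Local Notation E := 'rV[R]_k.
Variables (Z : set E) (r : E -> R).
Hypotheses (cZ : compact Z)
  (convZ : forall x y t, Z x -> Z y -> 0 <= t <= 1 -> Z (x + t *: (y - x)))
  (convr : forall x y t, Z x -> Z y -> 0 <= t <= 1 ->
     r (x + t *: (y - x)) <= r x + t * (r y - r x))
  (lscr : lsc_on Z r).

Lemma lsc_onD (f : E -> R) : continuous f -> lsc_on Z (fun x => r x + f x).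
Proof.
move=> cf x a Zx axf; pose e := (r x + f x - a) / 2.
have e0 : 0 < e by rewrite /e; lra.
have /lscr : r x - e < r x by lra.
move=> /(_ Zx) h; near=> y => Zy.
have ry : r x - e < r y by apply: (near h y) => //.
have fy : f x - e < f y by near: y; apply: (cvgr_gt (f x) (cf x)); lra.
by move: ry fy; rewrite /e; lra.
Unshelve. all: by end_near. Qed.

(** First-order optimality: moving from [x] a fraction [t] of the way to [v] changes the objective
    by at most t a + t^2 (q / 2) |v - x|^2, where [a >= 0] is the subgradient inequality.
    Nonnegativity for small [t] forces it. *)
Lemma argmin_subdiff zeta (q : R) y x : 0 <= q -> Z x ->
  (forall v, Z v ->
     r x + (pairing zeta x + q / 2 * pairing (x - y) (x - y)) <=
     r v + (pairing zeta v + q / 2 * pairing (v - y) (v - y))) ->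
  subdiff Z r x (- zeta - q *: (x - y)).
Proof.
move=> q0 Zx xmin v Zv.
have [w wE] : exists w, w = v - x by exists (v - x).
rewrite -wE; set a := r v - r x + pairing zeta w + q * pairing (x - y) w.
have key t : 0 < t <= 1 -> 0 <= a + t * (q / 2 * pairing w w).
  move=> /andP[t0 t1]; have t01 : 0 <= t <= 1 by rewrite (ltW t0).
  have := xmin _ (convZ Zx Zv t01); have := convr Zx Zv t01.
  rewrite -wE -(pmulr_rge0 _ t0) /a; set p := x - y.
  have -> : x + t *: w - y = p + t *: w by rewrite /p addrAC.
  move: p => p; rewrite !pairingE (pairingC w p); nra.
have a0 : 0 <= a.
  rewrite leNgt; apply/negP => a0.
  have p0 := pairing_ge0 w; set p := q / 2 * pairing w w.
  have {}p0 : 0 <= p by rewrite /p mulr_ge0// divr_ge0.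
  (* For this [t], a + t p = a (1 - a) / (p + 1 - a), which is negative when [a] is. *)
  pose t := - a / (p + 1 - a).
  have d0 : 0 < p + 1 - a by lra.
  have tE : t * (p + 1 - a) = - a by rewrite /t divfK// gt_eqF.
  have t0 : 0 < t by rewrite /t divr_gt0//; lra.
  have t1 : t <= 1 by rewrite /t ler_pdivrMr//; lra.
  by have := key t; rewrite t0 t1 => /(_ isT); rewrite -/p; nra.
by move: a0; rewrite /a !pairingE; lra.
Qed.

Lemma pairing_sub_continuous (y : E) : continuous (fun x : E => pairing (x - y) (x - y)).
Proof.
move=> x; have cB : {for x, continuous (fun x : E => x - y)}.
  by apply: (@cvgB R E _ (nbhs x) _ id (cst y)); [exact: cvg_id|exact: cvg_cst].
exact: (pairing_continuous cB cB).
Qed.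

Lemma pairing_linear_continuous (zeta : E) : continuous (pairing zeta).
Proof.
move=> x; have c1 : {for x, continuous (cst zeta : E -> E)} by exact: cst_continuous.
have c2 : {for x, continuous (id : E -> E)} by exact: cvg_id.
exact: (pairing_continuous c1 c2).
Qed.

Lemma quadratic_argmin zeta (q : R) y : Z !=set0 -> 
  exists2 x, Z x & forall v, Z v ->
     r x + (pairing zeta x + q / 2 * pairing (x - y) (x - y)) <=
     r v + (pairing zeta v + q / 2 * pairing (v - y) (v - y)).
Proof.
move=> Z0; apply: lsc_on_min => //; apply: lsc_onD => x.
apply: (@cvgD R R^o _ (nbhs x) _ (pairing zeta)
  (fun v => q / 2 * pairing (v - y) (v - y))).
  exact: pairing_linear_continuous.
apply: (@cvgM _ _ (nbhs x) _ (fun=> q / 2)); first exact: cvg_cst.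
exact: pairing_sub_continuous.
Qed.

(** The minimiser of [r] plus a steep quadratic centred at [u] has a subgradient, and it stays near
    [u]: (q / 2) |x - u|^2 <= r u - r x <= r u - b, which is below q e^2 / 2 by the choice of
    [q]. *)
Lemma subdiff_dense u e : Z u -> has_lbound (r @` Z) -> 0 < e ->
  exists x, [/\ Z x, subdiff Z r x !=set0 & `|x - u| < e].
Proof.
move=> Zu [b rb] e0.
pose q := 2 * (r u - b + 1) / e ^+ 2.
have bu : b <= r u by apply: rb; exists u.
have q0 : 0 < q by rewrite divr_gt0 ?exprn_gt0//; lra.
have [|x Zx xmin] := @quadratic_argmin 0 q u; first by exists u.
exists x; split => //; first by eexists; apply: argmin_subdiff xmin; rewrite // ltW.
have := xmin _ Zu; rewrite subrr !(pairingC 0) !pairing0r mulr0 !addr0 add0r => h.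
have bx : b <= r x by apply: rb; exists x.
have qE : q * e ^+ 2 = 2 * (r u - b + 1) by rewrite /q divfK// gt_eqF// exprn_gt0.
rewrite -(@ltr_pXn2r _ 2)// ?nnegrE ?(ltW e0)//.
apply: (le_lt_trans (sqr_norm_le_pairing _)).
by rewrite -(ltr_pM2l q0) qE; lra.
Qed.

End Subgradients.

(** * Bregman divergences *)

Section DistanceGenerating.
Local Open Scope convex_scope.
Context {R : realType} {k : nat}.
Local Notation E := 'rV[R]_k.
Variables (Z : set E) (nrm r : E -> R).
Hypotheses (cZ : compact Z) (convZ : convex_set Z) (hr : distance_generating Z nrm r).

Definition dom_subdiff (Z : set E) (r : E -> R) :=
  [set z | Z z /\ subdiff Z r z !=set0].

(** One subgradient attains the supremum of [grad_pairing] in all feasible directions at once, so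
    that [grad_pairing] is linear on them. *)
Definition gradient_selection (Z : set E) (r : E -> R) (gr : E -> E) :=
  forall z, dom_subdiff Z r z -> subdiff Z r z (gr z) /\
    forall s u, subdiff Z r z s -> Z u -> pairing s (u - z) <= pairing (gr z) (u - z).

Lemma convE (V : lmodType R) (x y : convex_lmodType V) (t : {i01 R}) :
  x <| t |> y = (t%:num *: (x : V) + (1 - t%:num) *: (y : V)) :> V.
Proof. by []. Qed.

Lemma convex_setP x y t : Z x -> Z y -> 0 <= t <= 1 -> Z (x + t *: (y - x)).
Proof.
move=> /mem_set Zx /mem_set Zy /andP[t0 t1].
have /set_mem := convZ (Itv01 t0 t1) Zy Zx; rewrite convE/=.
congr (Z _); rewrite scalerBr scalerBl scale1r addrC -!addrA; congr (_ + _).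
by rewrite addrC.
Qed.

Lemma dg_convexP x y t : Z x -> Z y -> 0 <= t <= 1 ->
  r (x + t *: (y - x)) <= r x + t * (r y - r x).
Proof.
move=> /mem_set Zx /mem_set Zy /andP[t0 t1].
have := @dg_convex _ _ _ _ _ hr (Itv01 t0 t1) y x Zy Zx; rewrite !convE/=.
have -> : t *: y + (1 - t) *: x = x + t *: (y - x).
  rewrite scalerBr scalerBl scale1r addrC -!addrA; congr (_ + _).
  by rewrite addrC.
move=> /le_trans; apply.
by rewrite (_ : (r y : R^o) <| Itv01 t0 t1 |> r x = t * r y + (1 - t) * r x)//; lra.
Qed.

Lemma dg_lsc_on : lsc_on Z r.
Proof.
move=> x a Zx ax.
have := dg_lsc hr (x := x) (a := a); rewrite mem_set// lte_fin => /(_ ax)[V Vx h].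
apply: filterS Vx => y /h + Zy; by rewrite mem_set// lte_fin.
Qed.

Lemma grad_pairing_fin z u : dom_subdiff Z r z -> Z u ->
  exists a, [/\ grad_pairing Z r z (u - z) = a%:E,
    forall s, subdiff Z r z s -> pairing s (u - z) <= a &
    forall M, (forall s, subdiff Z r z s -> pairing s (u - z) <= M) -> a <= M].
Proof.
move=> [Zz [s0 hs0]] Zu.
have ub M : (forall s, subdiff Z r z s -> pairing s (u - z) <= M) ->
    (grad_pairing Z r z (u - z) <= M%:E)%E.
  by move=> h; apply: ge_ereal_sup => _ [s hs <-]; rewrite lee_fin h.
have lb s : subdiff Z r z s -> ((pairing s (u - z))%:E <= grad_pairing Z r z (u - z))%E.
  by move=> hs; apply: ereal_sup_ubound; exists s.
have : grad_pairing Z r z (u - z) \is a fin_num.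
  rewrite fin_numE -ltNye -ltey; apply/andP; split.
    by apply: lt_le_trans (lb _ hs0); rewrite ltNyr.
  apply: (@le_lt_trans _ _ (r u - r z)%:E); last by rewrite ltry.
  by apply: ub => s /(_ _ Zu); lra.
move=> /fineK aE; exists (fine (grad_pairing Z r z (u - z))); split=> //.
  by move=> s /lb; rewrite -aE lee_fin.
by move=> M /ub; rewrite -aE lee_fin.
Qed.

Lemma dg_strongly_convexP z u s : Z z -> Z u -> subdiff Z r z s ->
  r z + pairing s (u - z) + nrm (u - z) ^+ 2 / 2 <= r u.
Proof.
move=> Zz Zu hs; have domz : dom_subdiff Z r z by split=> //; exists s.
have := dg_strongly_convex hr Zz Zu.
have [a [-> ha _]] := grad_pairing_fin domz Zu.
by rewrite -!EFinD lee_fin; have := ha _ hs; lra.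
Qed.

(* The three-point identity makes all subgradients at [z] agree with [gr z] in
   the direction of points having subgradients, and these are dense in [Z]. *)
Lemma exists_gradient_selection : exists gr, gradient_selection Z r gr.
Proof.
have [gr grP] := dg_three_point hr; exists gr => z domz.
have [Zz s0] := domz.
have grz : subdiff Z r z (gr z) by have [] := grP _ _ _ Zz Zz Zz s0 s0.
split=> // s u hs.
have in_dom v : dom_subdiff Z r v -> pairing s (v - z) <= pairing (gr z) (v - z).
  move=> domv; have [Zv v0] := domv.
  have grv : subdiff Z r v (gr v) by have [] := grP _ _ _ Zv Zv Zv v0 v0.
  (* With third point [z] the identity says that <gr z, v - z> + <gr v, z - v> is the sum [a + b] of
     the two suprema. Neither summand exceeds its supremum, so both attain it. *)
  have [_] := grP _ _ _ Zz Zv Zz s0 v0.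
  rewrite /bregman.
  have [a [-> ha _]] := grad_pairing_fin domz Zv.
  have [b [-> hb _]] := grad_pairing_fin domv Zz.
  have [c [-> hc hc']] := grad_pairing_fin domz Zz.
  have c0 : c = 0.
    apply/le_anti/andP; split; last by have := hc _ grz; rewrite subrr pairing0r.
    by apply: hc' => s' _; rewrite subrr pairing0r.
  rewrite c0 -!EFinB => -[].
  have := ha _ grz; have := ha _ hs; have := hb _ grv.
  rewrite !pairingE; lra.
move=> Zu; rewrite -subr_ge0 -pairingBl leNgt; apply/negP => neg.
pose f v := pairing (gr z - s) (v - z).
have cf : continuous f.
  move=> v; have c1 : {for v, continuous (cst (gr z - s) : E -> E)} by exact: cst_continuous.
  have c2 : {for v, continuous (fun v : E => v - z)}.
    by apply: (@cvgB R E _ (nbhs v) _ id (cst z)); [exact: cvg_id|exact: cvg_cst].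
  exact: (pairing_continuous c1 c2).
have : \forall v \near u, f v < 0 by apply: (cvgr_lt (f u) (cf u)).
move=> /nbhs_ballP[e /= e0 he].
have [v [Zv sv vu]] := subdiff_dense cZ convex_setP dg_convexP dg_lsc_on Zu (dg_bounded hr).2 e0.
have := he v; rewrite mx_norm_ball /ball_/= distrC => /(_ vu).
by rewrite /f pairingBl ltNge subr_ge0 in_dom.
Qed.

End DistanceGenerating.

Section Bregman.
Context {R : realType} {k : nat}.
Local Notation E := 'rV[R]_k.
Variables (Z : set E) (nrm r : E -> R).
Hypotheses (cZ : compact Z) (convZ : convex_set Z) (hr : distance_generating Z nrm r)
  (nrmP : is_norm nrm).
Variable gr : E -> E.
Hypothesis grP : gradient_selection Z r gr.

Local Notation dom := (dom_subdiff Z r).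

Definition breg (r : E -> R) (gr : E -> E) z u := r u - r z - pairing (gr z) (u - z).
Local Notation V := (breg r gr).

Lemma bregmanE z u : dom z -> Z u -> bregman Z r z u = (V z u)%:E.
Proof.
move=> domz Zu; have [a [aE ha ha']] := grad_pairing_fin domz Zu.
rewrite /bregman aE -!EFinB; congr (_%:E); rewrite /breg; congr (_ - _).
have [grz h] := grP domz.
by apply/le_anti/andP; split; [apply: ha' => s hs; exact: h|exact: ha].
Qed.

Lemma bregman_pinfty z u : ~ (subdiff Z r z !=set0) -> bregman Z r z u = +oo%E.
Proof.
move=> s0; rewrite /bregman /grad_pairing.
rewrite (_ : [set _ | _ in _] = set0) ?ereal_sup0//.
by rewrite -subset0 => y [s hs _]; apply: s0; exists s.
Qed.

Lemma breg_ge z u : dom z -> Z u -> nrm (u - z) ^+ 2 / 2 <= V z u.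
Proof.
move=> domz Zu; have [grz _] := grP domz.
have := dg_strongly_convexP hr domz.1 Zu grz; rewrite /breg; lra.
Qed.

Lemma breg_ge0 z u : dom z -> Z u -> 0 <= V z u.
Proof.
by move=> dz Zu; apply: le_trans (breg_ge dz Zu); rewrite divr_ge0// sqr_ge0.
Qed.

Lemma breg_self z : V z z = 0.
Proof. by rewrite /breg !subrr pairing0r subr0. Qed.

Lemma breg_three_point z w u :
  V z u - V w u - V z w = pairing (gr w - gr z) (u - w).
Proof. by rewrite /breg !pairingE; lra. Qed.

Lemma subdiff_monotone z z' s s' : Z z -> Z z' ->
  subdiff Z r z s -> subdiff Z r z' s' ->
  nrm (z - z') ^+ 2 <= pairing (s - s') (z - z').
Proof.
move=> Zz Zz' hs hs'.
have := dg_strongly_convexP hr Zz Zz' hs.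
have := dg_strongly_convexP hr Zz' Zz hs'.
by rewrite (nrm_distC nrmP z' z) !pairingE; lra.
Qed.

Lemma subdiff_inj z z' s : Z z -> Z z' ->
  subdiff Z r z s -> subdiff Z r z' s -> z = z'.
Proof.
move=> Zz Zz' hs hs'; have := subdiff_monotone Zz Zz' hs hs'.
rewrite subrr pairingC pairing0r => h.
apply/eqP; rewrite -subr_eq0; apply: contraTT h => /(nrm_gt0 nrmP) n0.
by rewrite -ltNge exprn_gt0.
Qed.

(** [Q] is the gradient of the convex conjugate of [r] on [Z]: minimising r - <s, .> over the
    compact [Z] yields a point with subgradient [s]. Strong monotonicity of the subdifferential
    makes [Q] Lipschitz for the Euclidean norm. *)
Lemma exists_conj_grad : Z !=set0 -> exists Q : E -> E,
  [/\ forall s, Z (Q s) /\ subdiff Z r (Q s) s & continuous Q].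
Proof.
move=> Z0.
have ex s : exists x, Z x /\ subdiff Z r x s.
  have [x Zx xmin] := @quadratic_argmin _ _ Z r cZ (dg_lsc_on hr) (- s) 0 0 Z0.
  exists x; split=> //.
  have := argmin_subdiff (convex_setP convZ) (dg_convexP hr) (lexx 0) Zx xmin.
  by rewrite opprK scale0r subr0.
pose Q s := projT1 (cid (ex s)).
have QP s : Z (Q s) /\ subdiff Z r (Q s) s by exact: projT2 (cid (ex s)).
exists Q; split=> //.
have [m m0 hm] := pairing_le_nrm2 nrmP.
have lip s t : pairing (Q s - Q t) (Q s - Q t) <= m^-1 ^+ 2 * pairing (s - t) (s - t).
  have := subdiff_monotone (QP s).1 (QP t).1 (QP s).2 (QP t).2.
  have := hm (Q s - Q t); have := pairing_ge0 (m^-1 *: (s - t) - (Q s - Q t)).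
  move: (Q s - Q t) (s - t) => a b; rewrite !pairingE (pairingC a b) expr2 -mulrA.
  have : m * (m^-1 * pairing b a) = pairing b a by rewrite mulrA divff ?mul1r// gt_eqF.
  nra.
have C0 : 0 < m^-1 * (k%:R + 1) by rewrite mulr_gt0 ?invr_gt0// ltr_wpDl.
move=> s; apply/(@cvgrPdist_lt _ E _ (nbhs s)) => e e0.
have e'0 : 0 < e / (m^-1 * (k%:R + 1)) by rewrite divr_gt0.
apply/nbhs_ballP; exists (e / (m^-1 * (k%:R + 1))) => // t.
rewrite mx_norm_ball /ball_/= ltr_pdivlMr// => st; apply: le_lt_trans st.
rewrite -(@ler_pXn2r _ 2)// ?nnegrE ?mulr_ge0 ?invr_ge0 ?(ltW m0)//.
apply: (le_trans (sqr_norm_le_pairing _)); apply: (le_trans (lip _ _)).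
rewrite mulrC [leRHS]exprMn mulrC [X in _ <= _ * X]exprMn.
rewrite mulrCA ler_wpM2l ?sqr_ge0//.
apply: (le_trans (ler_norm _)); apply: (le_trans (pairing_le_norm _ _)).
rewrite mulrC -expr2 ler_wpM2l ?sqr_ge0// expr2.
by have : 0 <= k%:R :> R by []; nra.
Qed.

End Bregman.

(** * Mirror steps and the regularised variational inequality *)

Section MirrorStep.
Context {R : realType} {k : nat}.
Local Notation E := 'rV[R]_k.
Variables (Z : set E) (nrm r : E -> R).
Hypotheses (cZ : compact Z) (convZ : convex_set Z) (hr : distance_generating Z nrm r)
  (nrmP : is_norm nrm).
Variable gr : E -> E.
Hypothesis grP : gradient_selection Z r gr.
Variable Q : E -> E.
Hypothesis QP : forall s, Z (Q s) /\ subdiff Z r (Q s) s.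

Local Notation dom := (dom_subdiff Z r).
Local Notation V := (breg r gr).

Lemma conj_grad_dom s : dom (Q s).
Proof. by have [ZQ sQ] := QP s; split=> //; exists s. Qed.

(** The subgradient of [r] that the first-order condition of the mirror step prescribes at its
    solution. *)
Definition mirror_dual (alpha eta : R) (w0 w' gamma : E) : E :=
  (alpha + eta^-1)^-1 *: (alpha *: gr w0 + eta^-1 *: gr w' - gamma).

(** Strong convexity leaves only one point with a given subgradient. This turns iterates specified
    as arg mins into explicit functions of the seeds. *)
Lemma mirror_step_argmin alpha eta w0 w' gamma w : 0 < alpha -> 0 < eta ->
  dom w0 -> dom w' ->
  is_argmin Z (fun v => ((pairing gamma v)%:E + alpha%:E * bregman Z r w0 v
     + (eta^-1)%:E * bregman Z r w' v)%E) w ->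
  w = Q (mirror_dual alpha eta w0 w' gamma).
Proof.
move=> a0 e0 d0 d' [Zw wmin].
have ae0 : 0 < alpha + eta^-1 by rewrite addr_gt0// invr_gt0.
apply: (subdiff_inj hr nrmP Zw (QP _).1 _ (QP _).2) => v Zv.
rewrite -(ler_pM2l ae0) mulrDr /mirror_dual pairingZl mulVKf ?gt_eqF//.
have := wmin v Zv; rewrite !(bregmanE grP)// -!EFinM -!EFinD lee_fin /breg.
by rewrite !pairingE; lra.
Qed.

(** The optimality condition provides some subgradient at [w]; the selected one dominates it in the
    direction of [u], and the three-point identity for [breg] turns the result into divergences. *)
Lemma mirror_step_le alpha eta w0 w' gamma u : 0 < alpha -> 0 < eta -> Z u ->
  forall w, w = Q (mirror_dual alpha eta w0 w' gamma) ->
  pairing gamma (w - u) <= alpha * (V w0 u - V w u - V w0 w)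
    + eta^-1 * (V w' u - V w u - V w' w).
Proof.
move=> a0 e0 Zu w wE.
have ae0 : 0 < alpha + eta^-1 by rewrite addr_gt0// invr_gt0.
have [_ /(_ _ _ (QP _).2 Zu)] := grP (conj_grad_dom (mirror_dual alpha eta w0 w' gamma)).
rewrite -wE -(ler_pM2l ae0) {1}/mirror_dual pairingZl mulVKf ?gt_eqF//.
rewrite !breg_three_point; move: (gr w) => s.
rewrite -[w - u]opprB; move: (u - w) => d.
by rewrite !pairingE; lra.
Qed.

Lemma proximal_point_exists alpha (g : E -> E) L w0 : 0 < alpha -> 0 <= L -> dom w0 ->
  monotone_on Z g ->
  (forall z z', Z z -> Z z' -> dual_norm nrm (g z - g z') <= L * nrm (z - z')) ->
  exists2 z, dom z &
    forall u, Z u -> pairing (g z) (z - u) <= alpha * (V w0 u - V z u - V w0 z).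
Proof.
move=> a0 L0 d0 mg lg.
have [m m0 hm] := pairing_le_nrm2 nrmP.
have [c c0 hc] := nrm2_le_pairing nrmP.
pose K := c ^+ 2 * L ^+ 2.
have K0 : 0 <= K by rewrite mulr_ge0// sqr_ge0.
have gK z z' : Z z -> Z z' -> pairing (g z - g z') (g z - g z') <= K * pairing (z - z') (z - z').
  move=> Zz Zz'; apply: (le_trans (pairing_le_dual_sqr nrmP _ (ltW c0) hc)).
  have : dual_norm nrm (g z - g z') ^+ 2 <= L ^+ 2 * (c * pairing (z - z') (z - z')).
    apply: (@le_trans _ _ ((L * nrm (z - z')) ^+ 2)).
      by rewrite lerXn2r ?nnegrE ?dual_ge0// ?mulr_ge0 ?nrm_ge0// lg.
    by rewrite exprMn ler_wpM2l ?sqr_ge0.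
  by rewrite /K -(ler_pM2l c0) => /le_trans; apply; rewrite le_eqVlt; apply/orP; left;
    apply/eqP; ring.
(* [K] bounds the squared Euclidean Lipschitz constant of [g], and [m] is the strong convexity of
   [r] in the Euclidean norm. The weight [q], an inverse step size, is large enough that K / alpha^2
   <= q m. *)
pose q := K / (alpha ^+ 2 * m) + 1.
have q0 : 0 < q by rewrite ltr_wpDl// divr_ge0// mulr_ge0 ?sqr_ge0// ltW.
have qK : K <= q * (alpha ^+ 2 * m).
  rewrite mulrDl divfK ?gt_eqF ?mulr_gt0 ?exprn_gt0//.
  by rewrite mul1r lerDl mulr_ge0 ?sqr_ge0// ltW.
pose zeta z := alpha^-1 *: g z - gr w0.
have Z0 : Z !=set0 by exists w0; case: d0.
have lsr := dg_lsc_on hr.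
pose Phi z := sval (cid2 (@quadratic_argmin _ _ Z r cZ lsr (zeta z) q z Z0)).
have ZPhi z : Z (Phi z) by rewrite /Phi; case: cid2.
have sPhi z : subdiff Z r (Phi z) (- zeta z - q *: (Phi z - z)).
  apply: (argmin_subdiff (convex_setP convZ) (dg_convexP hr) (ltW q0) (ZPhi z)).
  by rewrite /Phi; case: cid2.
pose sq (x : E) := pairing x x.
(* Write d = z - z' and h = g z - g z'. In |q d - h / alpha|^2 the cross term has a favourable sign
   by monotonicity, and the term |h|^2 / alpha^2 is at most q m |d|^2. *)
have contr z z' : Z z -> Z z' ->
    (m + q / 2) * sq (Phi z - Phi z') <= (m / 2 + q / 2) * sq (z - z').
  move=> Zz Zz'.
  have := subdiff_monotone hr nrmP (ZPhi z) (ZPhi z') (sPhi z) (sPhi z').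
  move/(le_trans (hm _)).
  have -> : - zeta z - q *: (Phi z - z) - (- zeta z' - q *: (Phi z' - z'))
      = q *: (z - z') - q *: (Phi z - Phi z') - alpha^-1 *: (g z - g z').
    by apply/rowP => i; rewrite /zeta !mxE; ring.
  have := gK _ _ Zz Zz'; have := mg _ _ Zz' Zz.
  move: (Phi z - Phi z') (z - z') (g z - g z') => x d h.
  rewrite (pairingC h d) => dh hh.
  have hx : (alpha ^-1) ^+ 2 * pairing h h <= q * m * pairing d d.
    have /(le_trans hh) hh' := ler_wpM2r (pairing_ge0 d) qK.
    rewrite exprVn mulrC ler_pdivrMr ?exprn_gt0//; apply: (le_trans hh').
    by rewrite le_eqVlt; apply/orP; left; apply/eqP; ring.
  have := pairing_ge0 (q *: d - alpha^-1 *: h - q *: x).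
  rewrite !pairingE (pairingC x d) (pairingC h d) (pairingC h x).
  set b := alpha^-1 in hx *; have b0 : 0 < b by rewrite invr_gt0.
  rewrite expr2 in hx.
  move=> h1 /(ler_wpM2l (ltW q0)) h2.
  have dh' : 0 <= q * (b * pairing d h) by rewrite !mulr_ge0// ltW.
  rewrite /sq -(ler_pM2l q0); nra.
have cPhi : {within Z, continuous (fun z => sq (Phi z - z))}.
  have cP : {within Z, continuous Phi}.
    apply/subspace_continuousP => z Zz.
    apply/(@cvgrPdist_lt _ E _ (within Z (nbhs z))) => e e0.
    have e'0 : 0 < e / (k%:R + 1) by rewrite divr_gt0// ltr_wpDl.
    apply/nbhs_ballP; exists (e / (k%:R + 1)) => // y.
    rewrite mx_norm_ball /ball_/= ltr_pdivlMr ?ltr_wpDl// => + Zy.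
    apply: le_lt_trans.
    rewrite -(@ler_pXn2r _ 2)// ?nnegrE ?mulr_ge0//.
    apply: (le_trans (sqr_norm_le_pairing _)).
    have := contr _ _ Zz Zy; rewrite /sq.
    have := pairing_le_norm (z - y) (z - y); move=> /(le_trans (ler_norm _)).
    have := pairing_ge0 (z - y); have := pairing_ge0 (Phi z - Phi y).
    have : 0 <= `|z - y| by []; have : 0 <= k%:R :> R by [].
    move: (Phi z - Phi y) => a; move: (z - y) `|z - y| => b t k0 t0 a0' b0' bt ab.
    have {}ab : pairing a a <= pairing b b by nra.
    by apply: (le_trans ab); apply: (le_trans bt); rewrite exprMn -expr2 mulrC; nra.
  have cF : {within Z, continuous (fun z => Phi z - z)}.
    move=> z; apply: (@cvgB R E _ _ _ Phi id); first exact: cP.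
    exact: (@continuous_subspaceT _ _ Z id (fun x => cvg_id)).
  by move=> z; exact: (pairing_continuous (cF z) (cF z)).
have [z Zz zmin] := @EVT_min_rV _ _ _ _ Z0 cZ cPhi.
have {}Zz : Z z by rewrite inE in Zz.
have fix_z : Phi z = z.
  have := zmin (Phi z); rewrite inE => /(_ (ZPhi z)).
  have := contr _ _ (ZPhi z) Zz; have := pairing_ge0 (Phi z - z).
  rewrite -/(sq _) => s0 h1 h2.
  suff : sq (Phi z - z) = 0 by move/pairing_eq0/subr0_eq.
  by nra.
have sz : subdiff Z r z (- zeta z).
  by have := sPhi z; rewrite fix_z subrr scaler0 subr0.
exists z; first by split=> //; eexists; exact: sz.
move=> u Zu; have dz : dom z by split=> //; eexists; exact: sz.
have [_ /(_ _ _ sz Zu)] := grP dz.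
rewrite breg_three_point -(ler_pM2l a0) /zeta opprB -[z - u]opprB.
move: (u - z) => d; rewrite !pairingE mulrBr [alpha * (_ * _)]mulrA divff ?gt_eqF//.
by lra.
Qed.

End MirrorStep.

(** * Borel measurability *)

Section Borel.
Context {R : realType} {k : nat}.
Local Notation E := 'rV[R]_k.
Local Notation B := (borel_rV R k).

Lemma borel_rV_open (A : set E) : open A -> measurable (A : set B).
Proof. by move=> oA; apply: sub_sigma_algebra. Qed.

Lemma borel_rV_closed (A : set E) : closed A -> measurable (A : set B).
Proof. by move=> /closed_openC/borel_rV_open/measurableC; rewrite setCK. Qed.

Lemma borel_rV_compact (A : set E) : compact A -> measurable (A : set B).
Proof.
by move=> cA; apply: borel_rV_closed; apply: (@compact_closed E).
Qed.

Lemma continuous_measurable_borel_rV (f : E -> R) :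
  continuous f -> measurable_fun setT (f : B -> R).
Proof.
move=> /continuousP cf; apply: (measurability _ (RGenOpens.measurableE R)).
move=> _ [_ [a [b ->] <-]]; rewrite setTI; apply: borel_rV_open.
by apply: cf; exact: interval_open.
Qed.

Lemma measurable_coord i : measurable_fun setT (fun x : B => (x : E) 0 i).
Proof.
apply: (@continuous_measurable_borel_rV (fun x : E => x 0 i)).
exact: coord_continuous.
Qed.

Context {d : measure_display} {T : measurableType d}.
Implicit Types D : set T.

(** An open set is a countable union of rational boxes, and a box is a finite intersection of
    conditions on single coordinates. *)
Lemma measurable_borel_rV D (f : T -> B) :
  (forall i, measurable_fun D (fun t => (f t : E) 0 i)) -> measurable_fun D f.
Proof.
move=> mf mD; suff h : measurable_fun D f by exact: h.
apply: (@measurability _ _ T B D f (@open E)) => //.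
move=> _ [U oU <-].
pose box (p : 'rV[rat]_k * nat) :=
  [set x : E | forall i, `|x 0 i - ratr (p.1 0 i)| < p.2.+1%:R^-1].
have UE : U = \bigcup_(p in [set p | box p `<=` U]) box p.
  apply/seteqP; split; last by move=> x [p /= pU]; exact: pU.
  move=> x Ux; have := open_nbhs_nbhs (conj oU Ux).
  move=> /nbhs_ballP[e /= e0 xe].
  have [n ne] : exists n, n.+1%:R^-1 < e / 2 :> R.
    have e20 : 0 < e / 2 by rewrite divr_gt0.
    have [n _ /(_ n (leqnn n))] := near_infty_natSinv_lt (PosNum e20).
    by exists n.
  have n0 : 0 < n.+1%:R^-1 :> R by rewrite invr_gt0.
  have exq i : exists q : rat, `|x 0 i - ratr q| < n.+1%:R^-1.
    have xn : x 0 i - n.+1%:R^-1 < x 0 i by rewrite ltrBlDr ltrDl.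
    have [q] := rat_in_itvoo xn; rewrite in_itv/= => /andP[q1 q2].
    by exists q; rewrite ger0_norm ?subr_ge0 ?(ltW q2)// ltrBlDr -ltrBlDl.
  pose q : 'rV[rat]_k := \row_i projT1 (cid (exq i)).
  have qP i : `|x 0 i - ratr (q 0 i)| < n.+1%:R^-1.
    by rewrite mxE; exact: projT2 (cid (exq i)).
  exists (q, n) => //= y yq; apply: xe => /=.
  split=> // j i; rewrite (ord1 j).
  have := qP i; have := yq i => /= h1 h2.
  rewrite /ball/= (_ : x 0 i - y 0 i = (x 0 i - ratr (q 0 i)) - (y 0 i - ratr (q 0 i))).
    by apply: (le_lt_trans (ler_normB _ _)); rewrite (splitr e) ltrD// (lt_trans _ ne).
  by rewrite opprB addrA subrK.
have -> : D `&` f @^-1` U = \bigcup_p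
    (if `[< box p `<=` U >] then D `&` f @^-1` (box p) else set0).
  apply/seteqP; split=> [t [Dt]|t [p _]].
    by rewrite /preimage/= {1}UE => -[p pU pt]; exists p => //; rewrite asboolT.
  by case: asboolP => // pU [Dt pt]; split => //; exact: pU.
apply: countable_bigcupT_measurable => // p; case: ifPn => // _.
pose F i := D `&` (fun t => `|(f t : E) 0 i - ratr (p.1 0 i)|) @^-1` `]-oo, p.2.+1%:R^-1[.
have -> : D `&` f @^-1` (box p) = \big[setI/D]_(i < k) F i.
  apply/seteqP; split=> t.
    move=> [Dt ft]; elim/big_ind : _ => // i _.
    by split=> //=; rewrite in_itv/=; exact: ft.
  have FD : \big[setI/D]_(i < k) F i `<=` D.
    by elim/big_ind : _ => [//|A A' hA _ s [/hA]//|i _ s []].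
  move=> h; split; first exact: FD.
  by move=> i; move: h; rewrite (bigD1 i)//= => -[[_]] /=; rewrite in_itv.
elim/big_ind : _ => // [A A' mA mA'|i _]; first exact: measurableI.
have mi : measurable_fun D (fun t => `|(f t : E) 0 i - ratr (p.1 0 i)|).
  by apply: measurableT_comp => //; exact: measurable_funB.
exact: mi.
Qed.

End Borel.

Section BorelMaps.
Context {R : realType} {k : nat}.
Local Notation E := 'rV[R]_k.
Local Notation B := (borel_rV R k).

Lemma continuous_measurable_rV (f : E -> E) : continuous f ->
  measurable_fun setT (f : B -> B).
Proof.
move=> /continuousP cf; apply: (@measurability _ _ B B setT f (@open E)) => //.
by move=> _ [U oU <-]; rewrite setTI; apply: borel_rV_open; exact: cf.
Qed.

Lemma within_continuous_measurable_rV (Z : set E) (f : E -> E) : closed Z ->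
  {within Z, continuous f} -> measurable_fun (Z : set B) (f : B -> B).
Proof.
move=> cZ /continuousP cf.
apply: (@measurability _ _ B B Z f (@open E)) => //.
move=> _ [U oU <-]; have /open_subspaceP[V oV VE] := cf _ oU.
rewrite setIC -VE; apply: measurableI; first exact: borel_rV_open.
exact: borel_rV_closed.
Qed.

Lemma pairing_measurable {d' : measure_display} {T : measurableType d'} (D : set T)
    (f h : T -> B) : measurable_fun D f -> measurable_fun D h ->
  measurable_fun D (fun t => pairing (f t) (h t)).
Proof.
move=> mf mh; apply: measurable_sum => i; apply: measurable_funM.
  exact: (measurableT_comp (measurable_coord i) mf).
exact: (measurableT_comp (measurable_coord i) mh).
Qed.

Lemma rV_subr_measurable {d' : measure_display} {T : measurableType d'} (D : set T)
    (f h : T -> B) : measurable_fun D f -> measurable_fun D h ->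
  measurable_fun D ((fun t => (f t : E) - (h t : E)) : T -> B).
Proof.
move=> mf mh; apply: measurable_borel_rV => i.
rewrite (_ : (fun t => _) = fun t => (f t : E) 0 i - (h t : E) 0 i); last first.
  by apply/funext => t; rewrite !mxE.
apply: measurable_funB.
  exact: (measurableT_comp (measurable_coord i) mf).
exact: (measurableT_comp (measurable_coord i) mh).
Qed.

Lemma rV_addr_measurable {d : measure_display} {T : measurableType d} (D : set T)
    (f h : T -> B) : measurable_fun D f -> measurable_fun D h ->
  measurable_fun D ((fun t => (f t : E) + (h t : E)) : T -> B).
Proof.
move=> mf mh; apply: measurable_borel_rV => i.
rewrite (_ : (fun t => _) = fun t => (f t : E) 0 i + (h t : E) 0 i); last first.
  by apply/funext => t; rewrite !mxE.
apply: measurable_funD.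
  exact: (measurableT_comp (measurable_coord i) mf).
exact: (measurableT_comp (measurable_coord i) mh).
Qed.

Lemma rV_scale_measurable {d : measure_display} {T : measurableType d} (D : set T) (a : R)
    (f : T -> B) : measurable_fun D f ->
  measurable_fun D ((fun t => a *: (f t : E)) : T -> B).
Proof.
move=> mf; apply: measurable_borel_rV => i.
rewrite (_ : (fun t => _) = fun t => a * (f t : E) 0 i); last first.
  by apply/funext => t; rewrite !mxE.
apply: measurable_funM; first exact: measurable_cst.
exact: (measurableT_comp (measurable_coord i) mf).
Qed.

End BorelMaps.

(** * Measurability of subgradients *)

Section SubdiffMeasurable.
Context {R : realType} {k : nat}.
Local Notation E := 'rV[R]_k.
Local Notation B := (borel_rV R k).
Variables (Z : set E) (r : E -> R).
Hypotheses (cZ : compact Z) (lscr : lsc_on Z r).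

Local Notation dom := (dom_subdiff Z r).

Let closedZ : closed Z.
Proof. exact: (@compact_closed E). Qed.

(** In r z + <gamma, v - z> <= r v the moving value [r z] is on the smaller side, so lower
    semicontinuity of [r] lets the inequality pass to the limit. *)
Lemma subdiff_graph_closed :
  closed [set p : E * E | Z p.1 /\ subdiff Z r p.1 p.2].
Proof.
move=> p clp; have Zp : Z p.1.
  apply: closedZ => A Ap.
  have [q [[Zq _] Aq]] := clp (fst @^-1` A) (@cvg_fst _ _ (nbhs p.1) (nbhs p.2) _ _ Ap).
  by exists q.1.
split=> // v Zv; rewrite leNgt; apply/negP => neg.
pose f (q : E * E) := pairing q.2 (v - q.1).
have cf : {for p, continuous f}.
  apply: pairing_continuous; first exact: cvg_snd.
  by apply: (@cvgB R E _ (nbhs p) _ (cst v) fst); [exact: cvg_cst|exact: cvg_fst].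
pose e := (r p.1 + f p - r v) / 2.
have e0 : 0 < e by rewrite /e/f; lra.
have rp : r p.1 - e < r p.1 by lra.
have fp : \forall q \near p, f p - e < f q by apply: (cvgr_gt (f p) cf); lra.
have nr : \forall q \near p, Z q.1 -> r p.1 - e < r q.1.
  exact: (@cvg_fst _ _ (nbhs p.1) (nbhs p.2) _ _ (lscr Zp rp)).
have [q [[Zq sq] [fq rq]]] := clp _ (filterI fp nr).
by have := sq _ Zv; have := rq Zq; move: fq; rewrite -/(f q) /e; lra.
Qed.

Let closed_norm_le (M : R) : closed [set s : E | `|s| <= M].
Proof.
apply: (@preimage_closed _ _ (fun s : E => `|s|) [set x | x <= M]).
  by move=> x _; exact: norm_continuous.
exact: closed_le.
Qed.

(* The graph of the subdifferential is closed, so this set is a countable union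
   of projections of compact sets. *)
Lemma subdiff_section_measurable (C : set (E * E)) : closed C ->
  measurable ([set w | Z w /\ exists2 s, subdiff Z r w s & C (w, s)] : set B).
Proof.
move=> cC; pose S n := [set p : E * E | [/\ Z p.1 /\ subdiff Z r p.1 p.2,
   C p & Z p.1 /\ `|p.2| <= n%:R]].
have -> : [set w | Z w /\ exists2 s, subdiff Z r w s & C (w, s)]
    = \bigcup_n (fst @` S n).
  apply/seteqP; split=> [w [Zw [s ws Cs]]|w [n _ [[w' s] [/= [Zw ws] Cs _] <-]]].
    exists (Num.bound `|s|) => //; exists (w, s) => //; split=> //=; split=> //.
    by apply/ltW/archi_boundP.
  by split => //; exists s.
apply: bigcupT_measurable => n; apply: borel_rV_compact.
apply: continuous_compact.
  by apply: continuous_subspaceT => x; exact: cvg_fst.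
apply: (@subclosed_compact _ _ (Z `*` [set s | `|s| <= n%:R])).
- rewrite (_ : S n = [set p | Z p.1 /\ subdiff Z r p.1 p.2] `&` C `&`
     (fst @^-1` Z `&` snd @^-1` [set s | `|s| <= n%:R])).
    apply: closedI; first by apply: closedI => //; exact: subdiff_graph_closed.
    apply: closedI; apply: preimage_closed => //.
      by move=> x _; exact: cvg_fst.
      by move=> x _; exact: cvg_snd.
  by apply/seteqP; split=> [p [? ? []]|p [[]? ? []]].
- apply: compact_setX => //; apply: bounded_closed_compact.
    by exists n%:R; split=> // M nM s /= /le_trans; apply; exact: ltW.
  exact: closed_norm_le.
- by move=> p [_ _ []].
Qed.

Lemma dom_subdiff_measurable : measurable (dom : set B).
Proof.
have := @subdiff_section_measurable setT closedT; congr (measurable _).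
by apply/seteqP; split=> [w [Zw [s ws _]]|w [Zw [s ws]]]; split=> //; exists s.
Qed.

Lemma lsc_on_measurable : measurable_fun (Z : set B) r.
Proof.
move=> mZ; have h : measurable_fun (Z : set B) r; last exact: h.
apply: (measurability _ (RGenOInfty.measurableE R)).
move=> _ [_ [a ->] <-].
have -> : Z `&` r @^-1` `]a, +oo[ = Z `\` [set w | Z w /\ r w <= a].
  apply/seteqP; split=> w; rewrite /= in_itv/= andbT.
    by move=> [Zw aw]; split=> // -[_]; rewrite leNgt aw.
  by move=> [Zw h]; split=> //; rewrite ltNge; apply/negP => wa; exact: h.
apply: measurableD => //; apply: borel_rV_closed => w clw.
have Zw : Z w by apply: closedZ => A /clw [x [[Zx _] Ax]]; exists x.
split=> //; rewrite leNgt; apply/negP => aw.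
by have [x [[Zx xa] /(_ Zx)]] := clw _ (lscr Zw aw); rewrite ltNge xa.
Qed.

Variable gr : E -> E.
Hypothesis grP : gradient_selection Z r gr.

(** As [gr w] dominates every subgradient at [w], its pairing with [u - w] is at least [c] exactly
    when that of some subgradient is; this is a section over a closed condition. *)
Lemma pairing_selection_measurable u : Z u ->
  measurable_fun (dom : set B) (fun w : B => pairing (gr w) (u - w)).
Proof.
move=> Zu; apply: (measurability _ (RGenCInfty.measurableE R)).
move=> _ [_ [c ->] <-].
have := @subdiff_section_measurable [set p | c <= pairing p.2 (u - p.1)] _.
rewrite (_ : _ `&` _ = [set w | Z w /\ exists2 s, subdiff Z r w s & c <= pairing s (u - w)]).
  apply; apply: (@preimage_closed _ _ (fun p : E * E => pairing p.2 (u - p.1)) [set x | c <= x]).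
    move=> p _; apply: pairing_continuous; first exact: cvg_snd.
    by apply: (@cvgB R E _ (nbhs p) _ (cst u) fst); [exact: cvg_cst|exact: cvg_fst].
  exact: closed_ge.
apply/seteqP; split=> w.
  move=> [dw]; rewrite /= in_itv/= andbT => h; split; first by case: dw.
  by exists (gr w) => //; have [] := grP dw.
move=> [Zw [s ws h]]; have dw : dom w by split=> //; exists s.
split=> //=; rewrite in_itv/= andbT; have [_ /(_ _ _ ws Zu)] := grP dw.
exact: le_trans.
Qed.

End SubdiffMeasurable.

(** Take rows from [S] of the largest possible rank: appending another member of [S] cannot raise
    it, so that member is in the row space. *)
Lemma row_generators {F : fieldType} {k : nat} (S : set 'rV[F]_k) :
  exists d (A : 'M[F]_(d, k)), (forall i, S (row i A)) /\
    forall v, S v -> (v <= A)%MS.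
Proof.
pose P n := `[< exists d (A : 'M[F]_(d, k)), (forall i, S (row i A)) /\ \rank A = n >].
have exP : exists n, P n.
  by exists 0%N; apply/asboolP; exists 0%N, 0; split=> [[]//|]; exact: mxrank0.
have ubP n : P n -> (n <= k)%N.
  by move=> /asboolP[d [A [_ <-]]]; exact: rank_leq_col.
case: (ex_maxnP exP ubP) => n /asboolP[d [A [SA rA]]] nmax.
exists d, A; split=> // v Sv.
have Pv : P (\rank (col_mx A v)).
  apply/asboolP; exists (d + 1)%N, (col_mx A v); split=> // i.
  rewrite -(fintype.splitK i); case: (fintype.split i) => j /=.
    by rewrite rowKu; exact: SA.
  by rewrite rowKd (ord1 j) (_ : row 0 v = v)//; apply/rowP => l; rewrite mxE.
have AleC : (A <= col_mx A v)%MS by apply: (submx_trans (addsmxSl A v)); rewrite addsmxE.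
have vleC : (v <= col_mx A v)%MS by apply: (submx_trans (addsmxSr A v)); rewrite addsmxE.
apply: (submx_trans vleC).
by rewrite -(mxrank_leqif_sup AleC).2 eqn_leq (mxrankS AleC) rA/= nmax.
Qed.

Section MeasurableSelection.
Context {R : realType} {k : nat}.
Local Notation E := 'rV[R]_k.
Local Notation B := (borel_rV R k).
Variables (Z : set E) (nrm r : E -> R).
Hypotheses (cZ : compact Z) (convZ : convex_set Z) (hr : distance_generating Z nrm r).

Local Notation dom := (dom_subdiff Z r).

Let pairing_mulmx (x y : E) : pairing x y = (x *m y^T) 0 0.
Proof. by rewrite mxE; apply: eq_bigr => i _; rewrite mxE. Qed.

(* Subgradients matter only modulo the normals of the affine hull of [Z];
   projecting these away makes the selection determined by countably many
   directional values, hence measurable. *)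
Lemma exists_measurable_selection : exists2 gr : E -> E,
  gradient_selection Z r gr & measurable_fun (dom : set B) (gr : B -> B).
Proof.
have [Z0|nZ] := pselect (Z !=set0); last first.
  exists (fun=> 0); last exact: measurable_cst.
  by move=> z [Zz _]; exfalso; apply: nZ; exists z.
have [w0 Zw0] := Z0.
have [gr grP] := exists_gradient_selection cZ convZ hr.
have [d [A [AZ ZA]]] := row_generators [set u - w0 | u in Z].
(* [gr' w] depends on [gr w] only through its pairings with the rows of [A], which are differences
   of measurable directional values. Since A (pinvmx A) A = A, its pairings with the row space of
   [A] are those of [gr w]. *)
pose gr' w := gr w *m A^T *m (pinvmx A)^T.
have gr'E w u : dom w -> Z u -> pairing (gr' w) (u - w) = pairing (gr w) (u - w).
  move=> [Zw _] Zu.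
  have : (u - w <= A)%MS.
    have -> : u - w = (u - w0) - (w - w0) by rewrite opprB addrA subrK.
    by apply: addmx_sub; rewrite ?eqmx_opp; apply: ZA; [exists u|exists w].
  move=> /submxP[c ->]; rewrite !pairing_mulmx trmx_mul -!mulmxA; congr ((_ *m _) 0 0).
  have key : A^T *m (pinvmx A)^T *m A^T = A^T.
    by rewrite -!trmx_mul mulmxA mulmxKpV.
  by rewrite !mulmxA key.
exists gr'.
  move=> z dz; have [Zz _] := dz; have [grz h] := grP z dz; split.
    by move=> u Zu; rewrite gr'E//; exact: grz.
  by move=> s u zs Zu; rewrite gr'E//; exact: h.
apply: measurable_borel_rV => j.
rewrite (_ : (fun t => _) = fun w => \sum_(i < d) pairing (gr w) (row i A) * pinvmx A j i).
  apply: measurable_sum => i; apply: measurable_funM; last exact: measurable_cst.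
  have [u Zu <-] := AZ i.
  rewrite (_ : (fun x => _) = fun w => pairing (gr w) (u - w) - pairing (gr w) (w0 - w)).
    by apply: measurable_funB; apply: (pairing_selection_measurable cZ (dg_lsc_on hr) grP).
  by apply/funext => w; rewrite -pairingBr opprB addrA subrK.
apply/funext => w; rewrite mxE; apply: eq_bigr => i _; rewrite [X in _ * X = _]mxE; congr (_ * _).
by rewrite mxE; apply: eq_bigr => l _; rewrite !mxE.
Qed.

End MeasurableSelection.

(** * Integrals and independence *)

Section Integral.
Local Open Scope ereal_scope.
Context {R : realType} {d : measure_display} {T : measurableType d}
  (m : {measure set T -> \bar R}).

(** Dropping the negative part of [f] leaves suprema over simple functions, which are monotone. The
    form suits integrands such as the gap, a supremum over [u] whose measurability is not
    established. *)
Lemma integral_le_ge0 (f h : T -> \bar R) : (forall x, 0 <= h x) ->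
  (forall x, f x <= h x) -> \int[m]_x f x <= \int[m]_x h x.
Proof.
move=> h0 fh; rewrite integralE.
apply: (@le_trans _ _ (\int[m]_x (f ^\+ x))).
  rewrite -[leRHS]adde0 leeD2l// oppe_le0.
  by apply: integral_ge0 => x _; exact: funeneg_ge0.
rewrite !ge0_integralTE//; apply: ge_ereal_sup => _ [g /= gf <-].
apply: ereal_sup_ubound; exists g => //= x; apply: (le_trans (gf x)).
by rewrite funeposE ge_max fh h0.
Qed.

End Integral.

Section Independence.
Local Open Scope ereal_scope.
Context {R : realType} {d : measure_display} {Omega : measurableType d}
  (P : probability Omega R).

Definition sigma_of {I : Type} (F : I -> set_system Omega) (J : set I) :=
  <<s \bigcup_(i in J) F i >>.

(** The measures P (. [&] B) and P B * P (.) agree on finite intersections of events from the [F i]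
    with [i] in [J]. These form a pi-system, so the measures agree on the sigma-algebra it
    generates. *)
Lemma mutually_independent_sigma {I : choiceType} (D : set I)
    (F : I -> set_system Omega) (J : set I) (j : I) :
  mutually_independent P D F ->
  (forall i, D i -> setI_closed (F i) /\ F i setT) ->
  (forall i, D i -> F i `<=` measurable) ->
  J `<=` D -> D j -> ~ J j ->
  forall A B, sigma_of F J A -> F j B -> P (A `&` B) = P A * P B.
Proof.
move=> indep FI Fm JD Dj nJj A B JA FB.
have mB : measurable B by exact: Fm FB.
pose Pi := [set C : set Omega | exists (K : {fset I}) (S : I -> set Omega),
  [/\ [set` K] `<=` J, forall i, i \in K -> F i (S i) &
      C = \bigcap_(i in [set` K]) S i]].
have Pim : Pi `<=` measurable.
  move=> _ [K [S [KJ FS ->]]]; apply: fin_bigcap_measurable => // i iK.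
  by apply: (Fm i); [apply: JD; exact: KJ|exact: FS].
have PiI : setI_closed Pi.
  move=> _ _ [K [S [KJ FS ->]]] [K' [S' [KJ' FS' ->]]].
  (* An index occurring in only one of the two families gets the neutral factor [setT]. *)
  pose U i := (if i \in K then S i else setT) `&` (if i \in K' then S' i else setT).
  exists (K `|` K')%fset, U; split.
  - by move=> i /=; rewrite in_fsetU => /orP[/KJ|/KJ'].
  - move=> i; rewrite in_fsetU /U => iKK'.
    have Di : D i by apply: JD; case/orP: iKK' => [/KJ|/KJ'].
    have [FIi FTi] := FI i Di.
    by apply: FIi; case: ifPn => // iK; [exact: FS|exact: FS'].
  - apply/seteqP; split=> w.
      move=> [h h'] i /= _; split; case: ifPn => // iK; [exact: h|exact: h'].
    move=> h; split=> i /= iK.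
      by have := h i; rewrite /U /= in_fsetU iK => /(_ isT) [].
    by have := h i; rewrite /U /= in_fsetU iK orbT => /(_ isT) [].
have r0 : (0 <= fine (P B))%R by exact: fine_ge0.
pose m1 : {measure set Omega -> \bar R} := mrestr P mB.
pose m2 : {measure set Omega -> \bar R} := mscale (NngNum r0) P.
have PBE : (fine (P B))%:E = P B by rewrite fineK// fin_num_measure.
have eqPi C : Pi C -> m1 C = m2 C.
  move=> [K [S [KJ FS ->]]]; rewrite /m1 /m2/= /mrestr /mscale/= PBE.
  have jK : j \notin K by apply/negP => /KJ.
  (* With [B] placed at the free index [j], intersecting with [B] is again an intersection to which
     mutual independence applies. *)
  pose S' i := if i == j then B else S i.
  have -> : \bigcap_(i in [set` K]) S i `&` B = \bigcap_(i in [set` (j |` K)%fset]) S' i.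
    apply/seteqP; split=> w.
      move=> [h Bw] i /=; rewrite in_fset1U /S'; case: eqP => //= _; exact: h.
    move=> h; split; last by have := h j; rewrite /S' /= eqxx in_fset1U eqxx; apply.
    move=> i /= iK; have := h i; rewrite /S' /= in_fset1U iK orbT => /(_ isT).
    by case: eqP => // ij; move: iK jK; rewrite ij => ->.
  rewrite indep; last 2 first.
  - by move=> i /=; rewrite in_fset1U => /orP[/eqP->//|/KJ/JD].
  - move=> i; rewrite in_fset1U /S'; case: eqP => [->//|_ /= iK]; exact: FS.
  rewrite big_fsetU1//= {1}/S' eqxx; congr (_ * _).
  rewrite (indep K) => [|i /KJ/JD//|//].
  by apply: eq_fbigr => i iK _; rewrite /S'; case: eqP => // ij; move: iK jK; rewrite ij => ->.
have := @g_sigma_algebra_measure_unique _ _ _ Pi Pim (fun=> setT) _ _ m1 m2 PiI eqPi.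
have PiT : Pi setT.
  by exists fset0, (fun=> setT); split=> //; apply/seteqP; split.
move=> /(_ (fun=> PiT)) uniq.
have -> : P A * P B = m2 A by rewrite /m2/= /mscale/= PBE muleC.
apply: uniq.
- by apply/seteqP; split=> // w _; exists 0%N.
- move=> _; rewrite /m1/= /mrestr setTI; exact: (le_lt_trans (probability_le1 _ mB) (ltry _)).
move: JA; apply: smallest_sub; first exact: smallest_sigma_algebra.
move=> C [i Ji FC]; apply: sub_sigma_algebra; exists [fset i]%fset, (fun=> C).
split=> [l /=|l|]; rewrite ?in_fset1.
- by move=> /eqP ->.
- by move=> /eqP ->.
by apply/seteqP; split=> [w Cw l //|w /(_ i)/=]; rewrite in_fset1 eqxx; apply.
Qed.

(** This replaces conditioning on the past: the joint law of [X] and [Y] is a product, and Tonelli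
    integrates out the fresh variable [Y] with [X] frozen. *)
Lemma independent_integral {d1 d2 : measure_display} {T1 : measurableType d1}
    {T2 : measurableType d2} (mu : probability T2 R) (X : Omega -> T1) (Y : Omega -> T2)
    (f : T1 * T2 -> \bar R) :
  measurable_fun setT X -> measurable_fun setT Y ->
  (forall B, measurable B -> P (Y @^-1` B) = mu B) ->
  (forall A B, measurable A -> measurable B ->
     P (X @^-1` A `&` Y @^-1` B) = P (X @^-1` A) * P (Y @^-1` B)) ->
  measurable_fun setT f -> (forall p, 0 <= f p) ->
  \int[P]_w f (X w, Y w) = \int[P]_w \int[mu]_y f (X w, y).
Proof.
move=> mX mY Ymu XY mf f0.
have mXY : measurable_fun setT (fun w => (X w, Y w)) by exact: measurable_fun_pair.
pose X' : {mfun Omega >-> T1} := HB.pack X (isMeasurableFun.Build _ _ _ _ _ mX).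
pose Z' : {mfun Omega >-> (T1 * T2)%type} :=
  HB.pack (fun w => (X w, Y w)) (isMeasurableFun.Build _ _ _ _ _ mXY).
transitivity (\int[distribution P Z']_p f p).
  by rewrite ge0_integral_distribution.
transitivity (\int[(distribution P X' \x mu)]_p f p).
  apply: eq_measure_integral => A mA _.
  apply/esym/product_measure_unique => // B C mB mC.
  rewrite /distribution/= /pushforward -Ymu//.
  exact: XY.
rewrite fubini_tonelli1// ge0_integral_distribution//.
  exact: measurable_fun_fubini_tonelli_F.
by move=> x; apply: integral_ge0 => y _; exact: f0.
Qed.

End Independence.

(** * Centered estimators *)

Lemma probability_integral_cst {R : realType} {d : measure_display}
    {T : measurableType d} (P : probability T R) (c : R) :
  (\int[P]_x c%:E = c%:E)%E.
Proof. by have := expectation_cst P c; rewrite unlock. Qed.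

Section Centered.
Context {R : realType} {k : nat} {d : measure_display} {Xi : measurableType d}.
Local Notation E := 'rV[R]_k.
Local Notation B := (borel_rV R k).
Variables (mu : probability Xi R) (Z : set E) (nrm : E -> R) (g : E -> E)
  (gt : E -> E -> Xi -> E) (L : R).
Hypotheses (cZ : compact Z) (nrmP : is_norm nrm) (L0 : 0 < L)
  (gtm : stochastic_estimator Z gt)
  (gtc : forall z0, Z z0 -> centered mu Z nrm g gt L z0).

Let mZ : measurable (Z : set B).
Proof. exact: borel_rV_compact. Qed.

Lemma estimator_measurable z0 z : Z z0 -> Z z ->
  measurable_fun setT (gt z0 z : Xi -> B).
Proof.
move=> Zz0 Zz; pose c s : (B * B * Xi)%type := ((z0 : B, z : B), s).
pose f (p : (B * B * Xi)%type) : B := gt p.1.1 p.1.2 p.2.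
rewrite -[gt z0 z]/(f \o c).
apply: (@measurable_comp _ _ _ _ _ _ ((Z `*` Z) `*` setT : set (B * B * Xi)%type)).
- by apply: measurableX => //; apply: measurableX.
- by move=> _ [s _ <-].
- exact: gtm.
- by apply: measurable_fun_pair; [exact: measurable_cst|exact: measurable_id].
Qed.

Let sqdev z0 z s := dual_norm nrm (gt z0 z s - g z0) ^+ 2.

Lemma sqdev_measurable z0 z : Z z0 -> Z z -> measurable_fun setT (sqdev z0 z).
Proof.
move=> Zz0 Zz; apply: measurable_funX.
apply: (@measurableT_comp _ _ _ _ _ _ (fun x : B => dual_norm nrm (x - g z0)) _ (gt z0 z)).
  apply: continuous_measurable_borel_rV => x.
  apply: (@continuous_comp _ _ _ (fun x : E => x - g z0) (dual_norm nrm)).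
    by apply: (@cvgB R E _ (nbhs x) _ id (cst (g z0))); [exact: cvg_id|exact: cvg_cst].
  exact: dual_continuous.
exact: estimator_measurable.
Qed.

Lemma integral_sqdev_le z0 z : Z z0 -> Z z ->
  (\int[mu]_s (sqdev z0 z s)%:E <= (L ^+ 2 * nrm (z - z0) ^+ 2)%:E)%E.
Proof. by move=> Zz0 Zz; have [_] := gtc Zz0 Zz; rewrite unlock. Qed.

Lemma sqdev_integrable z0 z : Z z0 -> Z z -> mu.-integrable setT (EFin \o sqdev z0 z).
Proof.
move=> Zz0 Zz; apply/integrableP; split.
  by apply/measurable_EFinP; exact: sqdev_measurable.
apply: le_lt_trans (ltry (L ^+ 2 * nrm (z - z0) ^+ 2)).
apply: le_trans (integral_sqdev_le Zz0 Zz); rewrite le_eqVlt; apply/orP; left; apply/eqP.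
by apply: eq_integral => s _ /=; rewrite ger0_norm// sqr_ge0.
Qed.

(** First moments come from second ones: a product of two norms is at most the sum of their
    squares. *)
Lemma deviation_integrable z0 z v : Z z0 -> Z z ->
  mu.-integrable setT (EFin \o (fun s => pairing (gt z0 z s - g z0) v)).
Proof.
move=> Zz0 Zz.
have i1 : mu.-integrable setT (EFin \o cst (nrm v ^+ 2)).
  exact: finite_measure_integrable_cst.
apply: le_integrable (integrableD measurableT (sqdev_integrable Zz0 Zz) i1) => //.
  apply/measurable_EFinP; apply: pairing_measurable; last exact: measurable_cst.
  apply: rV_subr_measurable; last exact: measurable_cst.
  exact: estimator_measurable.
move=> s _ /=; rewrite lee_fin (le_trans (normr_pairing_le nrmP _ _))//.
rewrite ger0_norm ?addr_ge0 ?sqr_ge0// /sqdev.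
have := sqr_ge0 (dual_norm nrm (gt z0 z s - g z0) - nrm v).
have := sqr_ge0 (nrm v); have := sqr_ge0 (dual_norm nrm (gt z0 z s - g z0)).
by move: (dual_norm _ _) (nrm v) => a b; rewrite !expr2; nra.
Qed.

(** The mean is given coordinatewise; the coordinates are integrable because the deviation has a
    finite second moment, so linearity applies. *)
Lemma integral_deviation z0 z v : Z z0 -> Z z ->
  (\int[mu]_s (pairing (gt z0 z s - g z0) v)%:E = (pairing (g z - g z0) v)%:E)%E.
Proof.
move=> Zz0 Zz.
have coordE s i : (gt z0 z s - g z0) 0 i = pairing (gt z0 z s - g z0) (delta_mx 0 i).
  rewrite /pairing (bigD1 i)//= big1 ?addr0 ?mxE ?eqxx ?mulr1// => j ji.
  by rewrite !mxE (negbTE ji) mulr0.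
have intd i : mu.-integrable setT (EFin \o (fun s => (gt z0 z s - g z0) 0 i)).
  apply: eq_integrable (deviation_integrable (delta_mx 0 i) Zz0 Zz) => //.
  by move=> s _ /=; rewrite coordE.
have intg i : mu.-integrable setT (EFin \o (fun s => gt z0 z s 0 i)).
  have i1 : mu.-integrable setT (EFin \o cst (g z0 0 i)).
    exact: finite_measure_integrable_cst.
  apply: eq_integrable (integrableD measurableT (intd i) i1) => //.
  by move=> s _ /=; rewrite -EFinD !mxE subrK.
have Ed i : (\int[mu]_s ((gt z0 z s - g z0) 0 i)%:E = ((g z - g z0) 0 i)%:E)%E.
  transitivity (\int[mu]_s ((gt z0 z s 0 i)%:E - (g z0 0 i)%:E))%E.
    by apply: eq_integral => s _; rewrite -EFinB !mxE.
  rewrite integralB_EFin//; last exact: finite_measure_integrable_cst.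
  have [/(_ i) + _] := gtc Zz0 Zz; rewrite unlock => ->.
  by rewrite probability_integral_cst -EFinB !mxE.
transitivity (\int[mu]_s (\sum_(i < k) (v 0 i)%:E * ((gt z0 z s - g z0) 0 i)%:E))%E.
  apply: eq_integral => s _; rewrite /pairing -sumEFin.
  by apply: eq_bigr => i _; rewrite -EFinM mulrC.
rewrite integral_sum//; last by move=> i; apply: integrableZl => //; exact: intd.
rewrite /pairing -sumEFin; apply: eq_bigr => i _.
transitivity ((v 0 i)%:E * \int[mu]_s ((gt z0 z s - g z0) 0 i)%:E)%E.
  exact: (integralZl measurableT (intd i)).
by rewrite Ed -EFinM mulrC.
Qed.

(** The shape of the one-step bound. The second moment stays an integral, since only an upper bound
    on it is given. *)
Lemma integral_quadratic_deviation z0 z v (a b c : R) : Z z0 -> Z z ->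
  (\int[mu]_s (a * sqdev z0 z s + b * pairing (gt z0 z s - g z0) v + c)%:E
   = a%:E * \int[mu]_s (sqdev z0 z s)%:E + (b * pairing (g z - g z0) v + c)%:E)%E.
Proof.
move=> Zz0 Zz.
have i1 : mu.-integrable setT (fun s => a%:E * (sqdev z0 z s)%:E)%E.
  by apply: integrableZl => //; exact: sqdev_integrable.
have i2 : mu.-integrable setT (fun s => b%:E * (pairing (gt z0 z s - g z0) v)%:E)%E.
  by apply: integrableZl => //; exact: deviation_integrable.
have i3 : mu.-integrable setT (EFin \o cst c) by exact: finite_measure_integrable_cst.
transitivity (\int[mu]_s ((a%:E * (sqdev z0 z s)%:E) +
   ((b%:E * (pairing (gt z0 z s - g z0) v)%:E) + (EFin \o cst c) s)))%E.
  by apply: eq_integral => s _; rewrite /= -!EFinM -!EFinD addrA.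
rewrite integralD//; last exact: integrableD.
rewrite integralD// integralZl//; last exact: sqdev_integrable.
rewrite integralZl//; last exact: deviation_integrable.
rewrite integral_deviation// probability_integral_cst.
by rewrite -EFinM -EFinD.
Qed.

(** [g z - g z'] is the mean of [gt z' z s - g z'], whose dual norm [a] has mean square at most c^2
    for c = L |z - z'|. Integrating a <= a^2 / (2 c) + c / 2 gives [c] without Jensen; the case z =
    z' is separate because then [c] is 0. *)
Lemma centered_lipschitz z z' : Z z -> Z z' ->
  dual_norm nrm (g z - g z') <= L * nrm (z - z').
Proof.
move=> Zz Zz'; apply: dual_le => // v v1.
have [->|zz'] := eqVneq z z'.
  by rewrite !subrr pairingC pairing0r nrm0// mulr0.
have n0 : 0 < nrm (z - z') by rewrite nrm_gt0// subr_eq0.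
set c := L * nrm (z - z'); have c0 : 0 < c by rewrite mulr_gt0.
rewrite -lee_fin -[(pairing _ _)%:E](@integral_deviation z' z v)//.
have c20 : 0 < (2 * c)^-1 by rewrite invr_gt0 mulr_gt0.
apply: (@le_trans _ _ (\int[mu]_s ((2 * c)^-1 * sqdev z' z s +
    0 * pairing (gt z' z s - g z') v + c / 2)%:E)%E).
  apply: integral_le_ge0 => s; rewrite lee_fin mul0r addr0.
    by apply: addr_ge0; [apply: mulr_ge0; [exact: ltW|exact: sqr_ge0]|rewrite divr_ge0// ltW].
  apply: (@le_trans _ _ (dual_norm nrm (gt z' z s - g z'))).
    apply: (le_trans (pairing_le_dual nrmP _ _)).
    by rewrite ler_piMr ?dual_ge0.
  rewrite /sqdev; move: (dual_norm _ _) => a.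
  have -> : (2 * c)^-1 = c^-1 / 2 by rewrite invfM mulrC.
  have : c^-1 * c = 1 by rewrite mulVf// gt_eqF.
  have : 0 < c^-1 by rewrite invr_gt0.
  move: c^-1 => e e0 ec; have := mulr_ge0 (ltW e0) (sqr_ge0 (a - c)).
  have -> : e * (a - c) ^+ 2 = e * a ^+ 2 - 2 * a * (e * c) + c * (e * c) by ring.
  by rewrite ec; lra.
rewrite integral_quadratic_deviation// mul0r add0r.
apply: (@le_trans _ _ (((2 * c)^-1)%:E * (c ^+ 2)%:E + (c / 2)%:E)%E).
  rewrite leeD2r// lee_pmul2l ?lte_fin//.
  by rewrite [c ^+ 2]exprMn; exact: integral_sqdev_le.
rewrite -EFinM -EFinD lee_fin le_eqVlt; apply/orP; left; apply/eqP.
by field; rewrite gt_eqF.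
Qed.

End Centered.

(** * One phase of stochastic mirror descent *)

Section OneStep.
Context {R : realType} {k : nat} {d : measure_display} {Xi : measurableType d}.
Local Notation E := 'rV[R]_k.
Local Notation B := (borel_rV R k).
Variables (mu : probability Xi R) (Z : set E) (nrm r : E -> R) (g : E -> E)
  (gt : E -> E -> Xi -> E) (L D alpha eta : R) (gr Q : E -> E) (w0 z : E).
Hypotheses (cZ : compact Z) (hr : distance_generating Z nrm r) (nrmP : is_norm nrm)
  (L0 : 0 < L) (gtm : stochastic_estimator Z gt)
  (gtc : forall z0, Z z0 -> centered mu Z nrm g gt L z0)
  (gmono : monotone_on Z g)
  (hD : forall z z', Z z -> Z z' -> nrm (z - z') <= D)
  (a0 : 0 < alpha) (e0 : 0 < eta)
  (grP : gradient_selection Z r gr)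
  (grm : measurable_fun (dom_subdiff Z r : set B) (gr : B -> B))
  (QP : forall s, Z (Q s) /\ subdiff Z r (Q s) s)
  (Qc : continuous Q).

Local Notation dom := (dom_subdiff Z r).
Local Notation V := (breg r gr).
Local Notation dual := (dual_norm nrm).

Hypotheses (domw0 : dom w0) (domz : dom z)
  (zP : forall u, Z u -> pairing (g z) (z - u) <= alpha * (V w0 u - V z u - V w0 z)).

Let step u gamma := Q (mirror_dual gr alpha eta w0 u gamma).

(* The constant makes this potential nonnegative, so that expectations of it
   need no integrability argument. *)
Definition drift W w := eta^-1 * V w z + pairing (g W - g z) (w - z) + L * D ^+ 2.

Lemma drift_ge0 W w : Z W -> dom w -> 0 <= drift W w.
Proof.
move=> ZW dw; have [Zw _] := dw; have [Zz _] := domz.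
have := normr_pairing_le nrmP (g W - g z) (w - z).
rewrite ler_norml => /andP[+ _].
have V0 : 0 <= eta^-1 * V w z by rewrite mulr_ge0 ?invr_ge0 ?(ltW e0)// (breg_ge0 hr grP).
have : dual (g W - g z) * nrm (w - z) <= L * D ^+ 2.
  apply: (@le_trans _ _ (L * nrm (W - z) * nrm (w - z))).
    by rewrite ler_wpM2r ?nrm_ge0// (centered_lipschitz cZ nrmP L0 gtm gtc).
  rewrite -mulrA ler_pM2l// expr2.
  by apply: ler_pM; rewrite ?nrm_ge0// hD.
by rewrite /drift; lra.
Qed.

(** Adding the step inequality to [zP] at [w] cancels V_{w0}(z) and V_{w0}(w). The noise
    [gamma - g W] is paired with (w - u) + (u - z): by Young, the first part costs the squared dual
    norm and uses up V_u(w) / eta; the second has a computable mean, as [u] does not depend on the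
    fresh seed. *)
Lemma mirror_step_descent W u gamma : Z W -> dom u ->
  let w := step u gamma in
  alpha * V w z + alpha / 2 * nrm (w - z) ^+ 2 + drift W w <=
  eta / 2 * dual (gamma - g W) ^+ 2 + (-1) * pairing (gamma - g W) (u - z) +
  (eta^-1 * V u z + L * D ^+ 2).
Proof.
move=> ZW du; rewrite /=; have [Zz _] := domz.
have [w wE] : exists w, w = step u gamma by exists (step u gamma).
have dw : dom w by rewrite wE; exact: (conj_grad_dom QP).
have [Zw _] := dw.
rewrite -wE.
have h1 := mirror_step_le grP QP (alpha := alpha) (eta := eta) (w0 := w0) (w' := u)
  (gamma := gamma) a0 e0 Zz wE.
have h2 := zP Zw.
have h3 := ler_wpM2l (ltW a0) (breg_ge hr grP domz Zw).
have h4 : eta^-1 * (nrm (w - u) ^+ 2 / 2) <= eta^-1 * V u w.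
  by rewrite ler_wpM2l ?invr_ge0 ?(ltW e0)// (breg_ge hr grP).
have h5 : - pairing (gamma - g W) (w - u) <=
    eta / 2 * dual (gamma - g W) ^+ 2 + eta^-1 * (nrm (w - u) ^+ 2 / 2).
  have := normr_pairing_le nrmP (gamma - g W) (w - u).
  rewrite ler_norml => /andP[+ _].
  move: (pairing _ _) (dual _) (nrm (w - u)) => p a b h.
  have ee : eta^-1 * eta = 1 by rewrite mulVf// gt_eqF.
  have ei : 0 < eta^-1 by rewrite invr_gt0.
  have := mulr_ge0 (ltW ei) (sqr_ge0 (eta * a - b)).
  have -> : eta^-1 * (eta * a - b) ^+ 2 =
     eta * (eta^-1 * eta) * a ^+ 2 - 2 * (eta^-1 * eta) * a * b + eta^-1 * b ^+ 2 by ring.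
  by rewrite ee; lra.
move: h1 h2 h3 h4 h5; rewrite /drift -[z - w]opprB.
have -> : w - z = (w - u) + (u - z) by rewrite addrA subrK.
move: (w - u) (u - z) => x y; rewrite !pairingE; lra.
Qed.

Lemma mirror_step_expectation W u : Z W -> dom u ->
  (\int[mu]_s (let w := step u (gt W u s) in
     alpha * V w z + alpha / 2 * nrm (w - z) ^+ 2 + drift W w)%:E <=
  (eta / 2 * L ^+ 2 * nrm (u - W) ^+ 2 - pairing (g u - g W) (u - z) +
   (eta^-1 * V u z + L * D ^+ 2))%:E)%E.
Proof.
move=> ZW du; have [Zu _] := du; have [Zz _] := domz.
apply: (@le_trans _ _ (\int[mu]_s (eta / 2 * dual (gt W u s - g W) ^+ 2
   + (-1) * pairing (gt W u s - g W) (u - z) + (eta^-1 * V u z + L * D ^+ 2))%:E)%E).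
  have h s := mirror_step_descent (gt W u s) ZW du.
  apply: integral_le_ge0 => s; rewrite lee_fin; last exact: h.
  apply: le_trans (h s); have dw := conj_grad_dom QP (mirror_dual gr alpha eta w0 u (gt W u s)).
  apply: addr_ge0; last exact: drift_ge0.
  apply: addr_ge0; apply: mulr_ge0; rewrite ?sqr_ge0 ?divr_ge0 ?(ltW a0)//.
  exact: (breg_ge0 hr grP).
rewrite (integral_quadratic_deviation cZ nrmP gtm gtc)//.
apply: (@le_trans _ _ ((eta / 2)%:E * (L ^+ 2 * nrm (u - W) ^+ 2)%:E +
   (-1 * pairing (g u - g W) (u - z) + (eta^-1 * V u z + L * D ^+ 2))%:E)%E).
  rewrite leeD2r// lee_pmul2l ?lte_fin ?divr_gt0//.
  exact: (integral_sqdev_le gtc).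
rewrite -EFinM -EFinD lee_fin le_eqVlt; apply/orP; left; apply/eqP.
by ring.
Qed.

(* Turns Borel functions on [dom] into total ones, as Tonelli requires. *)
Definition retract (w : E) : E := if w \in dom then w else w0.

Lemma retract_dom w : dom (retract w).
Proof. by rewrite /retract; case: ifPn => // /set_mem. Qed.

Lemma retract_id w : dom w -> retract w = w.
Proof. by move=> dw; rewrite /retract mem_set. Qed.

Let mdom := dom_subdiff_measurable cZ (dg_lsc_on hr).

Lemma retract_measurable : measurable_fun setT (retract : B -> B).
Proof.
apply: measurable_fun_ifT; [|exact: measurable_id|exact: measurable_cst].
apply: (@measurable_fun_bool _ _ setT (fun w : B => w \in dom) true).
rewrite setTI (_ : _ @^-1` _ = dom)//.
by apply/seteqP; split=> w; [move=> /set_mem|move=> dw; apply/mem_set].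
Qed.

Lemma retract_comp {d' : measure_display} {T : measurableType d'} (f : B -> T) :
  measurable_fun (dom : set B) f -> measurable_fun setT (f \o (retract : B -> B)).
Proof.
move=> mf; apply: (@measurable_comp _ _ _ _ _ _ (dom : set B)) => //.
  by move=> _ [w _ <-]; exact: retract_dom.
exact: retract_measurable.
Qed.

Lemma breg_retract_measurable : measurable_fun setT (fun w : B => V (retract w) z).
Proof.
apply: (retract_comp (f := fun w => V w z)); apply: measurable_funB.
  apply: measurable_funB; first exact: measurable_cst.
  apply: measurable_funS (lsc_on_measurable cZ (dg_lsc_on hr)).
    exact: borel_rV_compact.
  by move=> w [].
apply: pairing_measurable => //.
by apply: rV_subr_measurable; [exact: measurable_cst|exact: measurable_id].
Qed.

Lemma nrm_retract_measurable c : measurable_fun setT (fun w : B => nrm (retract w - c)).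
Proof.
apply: (measurableT_comp (f := nrm : B -> R)).
  by apply: continuous_measurable_borel_rV; exact: nrm_continuous.
by apply: rV_subr_measurable; [exact: retract_measurable|exact: measurable_cst].
Qed.

Hypothesis gcont : {within Z, continuous g}.

Lemma drift_retract_measurable : measurable_fun setT
  (fun p : B * B => drift (retract p.1) (retract p.2)).
Proof.
have m1 := measurableT_comp retract_measurable (@measurable_fst _ _ B B).
have m2 := measurableT_comp retract_measurable (@measurable_snd _ _ B B).
apply: measurable_funD; last exact: measurable_cst.
apply: measurable_funD.
  apply: measurable_funM; first exact: measurable_cst.
  exact: (measurableT_comp breg_retract_measurable measurable_snd).
apply: pairing_measurable.
  apply: rV_subr_measurable; last exact: measurable_cst.
  apply: (measurableT_comp (f := g \o (retract : B -> B) : B -> B)); last exact: measurable_fst.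
  apply: (retract_comp (f := (g : B -> B))).
  apply: measurable_funS (within_continuous_measurable_rV _ gcont).
  - exact: borel_rV_compact.
  - by move=> w [].
  - exact: (@compact_closed E).
by apply: rV_subr_measurable => //; exact: measurable_cst.
Qed.

(** The arguments are the start of the phase, the current iterate and the seed; the seed is kept
    apart so that it can be integrated out. *)
Definition update (p : B * B * Xi) : B :=
  step (retract p.1.2) (gt (retract p.1.1) (retract p.1.2) p.2).

Lemma update_measurable : measurable_fun setT update.
Proof.
apply: (measurableT_comp (continuous_measurable_rV Qc)).
have m12 : measurable_fun setT (fun p : B * B * Xi => p.1.2).
  exact: (measurableT_comp measurable_snd measurable_fst).
have m11 : measurable_fun setT (fun p : B * B * Xi => p.1.1).
  exact: (measurableT_comp measurable_fst measurable_fst).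
apply: rV_scale_measurable; apply: rV_subr_measurable.
  apply: rV_addr_measurable; first exact: measurable_cst.
  by apply: rV_scale_measurable; exact: (measurableT_comp (retract_comp grm) m12).
pose c (p : (B * B * Xi)%type) : (B * B * Xi)%type := ((retract p.1.1, retract p.1.2), p.2).
pose f (p : (B * B * Xi)%type) : B := gt p.1.1 p.1.2 p.2.
have mZ : measurable (Z : set B) by exact: borel_rV_compact.
apply: (@measurable_comp _ _ _ _ _ _ ((Z `*` Z) `*` setT : set (B * B * Xi)%type) f setT c).
- by apply: measurableX => //; apply: measurableX.
- by move=> _ [p _ <-]; split=> //; split; [case: (retract_dom p.1.1)|case: (retract_dom p.1.2)].
- exact: gtm.
- apply: measurable_fun_pair; last exact: measurable_snd.
  by apply: measurable_fun_pair; exact: (measurableT_comp retract_measurable).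
Qed.

Context {dO : measure_display} {Omega : measurableType dO} (P : probability Omega R).
Variables (T : nat) (xi : nat -> Omega -> Xi) (u : nat -> Omega -> E).
Hypotheses (udom : forall t w, dom (u t w))
  (ustep : forall t w, (t < T)%N -> u t.+1 w = update (u 0%N w, u t w, xi t w))
  (um : forall t, (t <= T)%N -> measurable_fun setT (u t : Omega -> B))
  (xim : forall t, (t < T)%N -> measurable_fun setT (xi t))
  (xilaw : forall t A, (t < T)%N -> measurable A -> P (xi t @^-1` A) = mu A)
  (xiind : forall t (A : set (B * B)) C, (t < T)%N -> measurable A -> measurable C ->
     P ((fun w => (u 0%N w : B, u t w : B)) @^-1` A `&` xi t @^-1` C) =
     (P ((fun w => (u 0%N w : B, u t w : B)) @^-1` A) * P (xi t @^-1` C))%E)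
  (etaE : eta = alpha / (8 * L ^+ 2)) (T0 : (0 < T)%N)
  (hT : 4 / (eta * alpha) <= T%:R).

Let e t := (\int[P]_w (V (u t w) z)%:E)%E.
Let q t := (\int[P]_w (nrm (u t w - z) ^+ 2)%:E)%E.
Let h t := (\int[P]_w (drift (u 0%N w) (u t w))%:E)%E.

Let Ve_measurable t : (t <= T)%N -> measurable_fun setT (fun w => V (u t w) z).
Proof.
move=> tT; rewrite (_ : (fun w => _) = (fun w : B => V (retract w) z) \o u t).
  exact: (measurableT_comp breg_retract_measurable (um tT)).
by apply/funext => w /=; rewrite retract_id.
Qed.

Let nrm_measurable t : (t <= T)%N -> measurable_fun setT (fun w => nrm (u t w - z) ^+ 2).
Proof.
move=> tT; apply: measurable_funX.
rewrite (_ : (fun w => _) = (fun w : B => nrm (retract w - z)) \o u t).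
  exact: (measurableT_comp (nrm_retract_measurable z) (um tT)).
by apply/funext => w /=; rewrite retract_id.
Qed.

Let drift_measurable t : (t <= T)%N ->
  measurable_fun setT (fun w => drift (u 0%N w) (u t w)).
Proof.
move=> tT; rewrite (_ : (fun w => _) = (fun p : B * B => drift (retract p.1) (retract p.2))
   \o (fun w => (u 0%N w : B, u t w : B))).
  apply: (measurableT_comp drift_retract_measurable).
  by apply: measurable_fun_pair; exact: um.
by apply/funext => w /=; rewrite !retract_id.
Qed.

Let V_ge0 t w : 0 <= V (u t w) z.
Proof. exact: (breg_ge0 hr grP (udom t w) (proj1 domz)). Qed.

Let driftu_ge0 t w : 0 <= drift (u 0%N w) (u t w).
Proof. by apply: drift_ge0 => //; case: (udom 0 w). Qed.

Lemma ge0_integral_combine (a b : R) (f1 f2 f3 : Omega -> R) : 0 <= a -> 0 <= b ->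
  (forall w, 0 <= f1 w) -> (forall w, 0 <= f2 w) -> (forall w, 0 <= f3 w) ->
  measurable_fun setT f1 -> measurable_fun setT f2 -> measurable_fun setT f3 ->
  (\int[P]_w (a * f1 w + b * f2 w + f3 w)%:E =
   a%:E * \int[P]_w (f1 w)%:E + b%:E * \int[P]_w (f2 w)%:E + \int[P]_w (f3 w)%:E)%E.
Proof.
move=> a_ge0 b_ge0 f1_ge0 f2_ge0 f3_ge0 mf1 mf2 mf3.
under eq_integral => w _ do rewrite 2!EFinD 2!EFinM.
have m1 : measurable_fun setT (fun w => a%:E * (f1 w)%:E)%E.
  by under eq_fun do rewrite -EFinM; apply/measurable_EFinP; exact: measurable_funM.
have m2 : measurable_fun setT (fun w => b%:E * (f2 w)%:E)%E.
  by under eq_fun do rewrite -EFinM; apply/measurable_EFinP; exact: measurable_funM.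
rewrite ge0_integralD//; first last.
- exact/measurable_EFinP.
- by move=> w _; rewrite lee_fin.
- exact: emeasurable_funD.
- by move=> w _; rewrite -!EFinM -EFinD lee_fin addr_ge0 ?mulr_ge0.
rewrite ge0_integralD//; first last.
- by move=> w _; rewrite -EFinM lee_fin mulr_ge0.
- by move=> w _; rewrite -EFinM lee_fin mulr_ge0.
rewrite ge0_integralZl_EFin//; first last.
- exact/measurable_EFinP.
- by move=> w _; rewrite lee_fin.
rewrite ge0_integralZl_EFin//.
- by move=> w _; rewrite lee_fin.
- exact/measurable_EFinP.
Qed.

Let rhs W v := eta / 2 * L ^+ 2 * nrm (v - W) ^+ 2 - pairing (g v - g W) (v - z) +
   (eta^-1 * V v z + L * D ^+ 2).

(** The seed of the step is independent of the pair ([u 0], [u t]), so it can be integrated out with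
    that pair fixed, where [mirror_step_expectation] applies pointwise. *)
Let phase_step t : (t < T)%N ->
  (alpha%:E * e t.+1 + (alpha / 2)%:E * q t.+1 + h t.+1 <=
   \int[P]_w (rhs (u 0%N w) (u t w))%:E)%E.
Proof.
move=> tT; rewrite -ge0_integral_combine ?(ltW a0) ?divr_ge0 ?(ltW a0)//; first last.
- exact: drift_measurable.
- exact: nrm_measurable.
- exact: Ve_measurable.
- by move=> w; rewrite sqr_ge0.
pose H (p : B * B * Xi) := alpha * V (update p) z + alpha / 2 * nrm (update p - z) ^+ 2 +
  drift (retract p.1.1) (update p).
have domupdate p : dom (update p) by exact: (conj_grad_dom QP).
have H0 p : 0 <= H p.
  apply: addr_ge0; last by apply: drift_ge0 => //; case: (retract_dom p.1.1).
  apply: addr_ge0; apply: mulr_ge0; rewrite ?sqr_ge0 ?divr_ge0 ?(ltW a0)//.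
  exact: (breg_ge0 hr grP (domupdate p) (proj1 domz)).
have mH : measurable_fun setT H.
  have HE : H = (fun p => alpha * V (retract (update p)) z +
     alpha / 2 * nrm (retract (update p) - z) ^+ 2 +
     drift (retract p.1.1) (retract (update p))).
    by apply/funext => p; rewrite /H (retract_id (domupdate p)).
  rewrite HE; apply: measurable_funD.
    apply: measurable_funD; apply: measurable_funM => //.
      exact: (measurableT_comp breg_retract_measurable update_measurable).
    apply: measurable_funX.
    exact: (measurableT_comp (nrm_retract_measurable z) update_measurable).
  apply: (@measurableT_comp _ _ _ _ _ _
    (fun p : B * B => drift (retract p.1) (retract p.2)) setT
    (fun p : B * B * Xi => (p.1.1, update p))).
    exact: drift_retract_measurable.
  apply: measurable_fun_pair; last exact: update_measurable.
  exact: (measurableT_comp measurable_fst measurable_fst).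
pose X w : B * B := (u 0%N w, u t w).
have mX : measurable_fun setT X.
  by apply: measurable_fun_pair; apply: um => //; exact: ltnW.
apply: (@le_trans _ _ (\int[P]_w (EFin \o H) (X w, xi t w))%E).
  rewrite le_eqVlt; apply/orP; left; apply/eqP; apply: eq_integral => w _ /=.
  by rewrite /H ustep//= retract_id.
have mH' : measurable_fun setT (EFin \o H) by exact/measurable_EFinP.
have H0' p : (0 <= (EFin \o H) p)%E by rewrite /= lee_fin.
rewrite (independent_integral mX (xim tT) (fun A mA => xilaw tT mA)
  (fun A C mA mC => xiind tT mA mC) mH' H0').
have ineq w : (\int[mu]_s (EFin \o H) (X w, s) <= (rhs (u 0%N w) (u t w))%:E)%E.
  have [ZW _] := udom 0%N w; have dut := udom t w.
  apply: le_trans (mirror_step_expectation ZW dut).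
  rewrite le_eqVlt; apply/orP; left; apply/eqP; apply: eq_integral => s _ /=.
  by rewrite /H /X /update /= !retract_id.
apply: integral_le_ge0 => w; last exact: ineq.
by apply: le_trans (ineq w); apply: integral_ge0 => s _; rewrite lee_fin.
Qed.

(** Monotonicity between [v] and [z] replaces [g v] by [g z], which leaves exactly the bias carried
    by [drift]. The noise coefficient is eta L^2 / 2 = alpha / 16, doubled when |v - W|^2 is split
    at [z]. *)
Let rhs_le W v : Z W -> Z v -> rhs W v <=
  alpha / 8 * nrm (v - z) ^+ 2 + alpha / 8 * nrm (W - z) ^+ 2 + drift W v.
Proof.
move=> ZW Zv; rewrite /rhs /drift.
have [Zz _] := domz.
have eL : eta / 2 * L ^+ 2 = alpha / 16.
  by rewrite etaE; field; rewrite gt_eqF.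
have mono := gmono Zz Zv.
have tri : nrm (v - W) <= nrm (v - z) + nrm (W - z).
  rewrite (nrm_distC nrmP W z) (le_trans _ (nrmD nrmP _ _))//.
  by rewrite addrA subrK.
have sq : nrm (v - W) ^+ 2 <= 2 * nrm (v - z) ^+ 2 + 2 * nrm (W - z) ^+ 2.
  have := nrm_ge0 nrmP (v - W); move: tri.
  move: (nrm (v - W)) (nrm (v - z)) (nrm (W - z)) => a b c abc a_ge0.
  have := sqr_ge0 (b - c).
  have : a ^+ 2 <= (b + c) ^+ 2 by rewrite lerXn2r// nnegrE// (le_trans a_ge0).
  by rewrite !expr2; nra.
have := ler_wpM2l (ltW a0) sq.
rewrite eL; move: mono; rewrite !pairingBl; lra.
Qed.

Let e0E : (\int[P]_w (rhs (u 0%N w) (u 0%N w))%:E =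
  (eta^-1)%:E * e 0%N + (L * D ^+ 2)%:E)%E.
Proof.
have LD : 0 <= L * D ^+ 2 by rewrite mulr_ge0 ?sqr_ge0 ?(ltW L0).
have m0 := @Ve_measurable 0%N (leq0n _).
rewrite (eq_integral (fun w => (eta^-1 * V (u 0%N w) z + 0 * V (u 0%N w) z + L * D ^+ 2)%:E)).
  rewrite ge0_integral_combine ?invr_ge0 ?(ltW e0)//.
  by rewrite mul0e adde0 probability_integral_cst.
move=> w _; rewrite /rhs !subrr nrm0// expr0n/= mulr0 pairingC pairing0r.
by rewrite mul0r subr0 add0r addr0.
Qed.

Let etE t : (0 < t < T)%N -> (\int[P]_w (rhs (u 0%N w) (u t w))%:E <=
  (alpha / 8)%:E * q t + (alpha / 8)%:E * q 0%N + h t)%E.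
Proof.
move=> /andP[t0 tT].
rewrite -ge0_integral_combine ?divr_ge0 ?(ltW a0)//.
- apply: integral_le_ge0 => w; rewrite lee_fin.
    apply: addr_ge0 => //.
    by apply: addr_ge0; rewrite mulr_ge0 ?sqr_ge0// divr_ge0 ?(ltW a0).
  by apply: rhs_le; [case: (udom 0 w)|case: (udom t w)].
- by move=> w; rewrite sqr_ge0.
- by move=> w; rewrite sqr_ge0.
- by apply: nrm_measurable; exact: ltnW.
- exact: nrm_measurable.
- by apply: drift_measurable; exact: ltnW.
Qed.

Let e_ge0 t : (0 <= e t)%E.
Proof. by apply: integral_ge0 => w _; rewrite lee_fin. Qed.

Let q_ge0 t : (0 <= q t)%E.
Proof. by apply: integral_ge0 => w _; rewrite lee_fin sqr_ge0. Qed.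

Let h_ge0 t : (0 <= h t)%E.
Proof. by apply: integral_ge0 => w _; rewrite lee_fin. Qed.

Let q_le_e t : (t <= T)%N -> (q t <= 2%:E * e t)%E.
Proof.
move=> tT; rewrite -ge0_integralZl_EFin//; first last.
- exact/measurable_EFinP/Ve_measurable.
- by move=> w _; rewrite lee_fin.
apply: integral_le_ge0 => w; rewrite -EFinM lee_fin; first by rewrite mulr_ge0.
have := breg_ge hr grP (udom t w) (proj1 domz).
by rewrite (nrm_distC nrmP z); lra.
Qed.

(** As 1 / eta = 8 L^2 / alpha, the divergence term is at least (4 L^2 / alpha) |v - z|^2.
    Completing the square with (alpha / 16) |W - z|^2 absorbs the bias, which is at most L |W - z|
    |v - z| in size. The summand [0 * 0] fits the shape of [ge0_integral_combine]. *)
Let drift_lower W v : Z W -> dom v ->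
  L * D ^+ 2 <= 0 * 0 + alpha / 16 * nrm (W - z) ^+ 2 + drift W v.
Proof.
move=> ZW dv; have [Zz _] := domz; rewrite /drift.
have [Zv _] := dv.
have h1 : 4 * L ^+ 2 / alpha * nrm (v - z) ^+ 2 <= eta^-1 * V v z.
  have := breg_ge hr grP dv Zz; rewrite (nrm_distC nrmP z).
  have ei : 0 <= eta^-1 by rewrite invr_ge0 ltW.
  move/(ler_wpM2l ei) => /(le_trans _); apply.
  rewrite etaE invf_div le_eqVlt; apply/orP; left; apply/eqP.
  by field; rewrite gt_eqF.
have := normr_pairing_le nrmP (g W - g z) (v - z).
rewrite ler_norml => /andP[+ _].
have := ler_wpM2r (nrm_ge0 nrmP (v - z)) (centered_lipschitz cZ nrmP L0 gtm gtc ZW Zz).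
move: h1; move: (nrm (v - z)) (nrm (W - z)) (pairing _ _) (dual _) => a b p c.
have : 0 <= alpha^-1 * (2 * L * a - alpha / 4 * b) ^+ 2.
  by rewrite mulr_ge0 ?sqr_ge0// invr_ge0 ltW.
have -> : alpha^-1 * (2 * L * a - alpha / 4 * b) ^+ 2 =
  4 * L ^+ 2 / alpha * a ^+ 2 - L * b * a + alpha / 16 * b ^+ 2.
  by field; rewrite gt_eqF.
lra.
Qed.

Let hT_lower : ((L * D ^+ 2)%:E <= (alpha / 16)%:E * q 0%N + h T)%E.
Proof.
have := @ge0_integral_combine 0 (alpha / 16) (cst 0) (fun w => nrm (u 0%N w - z) ^+ 2)
  (fun w => drift (u 0%N w) (u T w)).
rewrite mul0e add0e => <-//; first last.
- exact: drift_measurable.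
- by apply: nrm_measurable.
- by move=> w; rewrite sqr_ge0.
- by rewrite divr_ge0 ?(ltW a0).
rewrite -(@probability_integral_cst _ _ _ P); apply: integral_le_ge0 => w.
  rewrite lee_fin; apply: le_trans (drift_lower (proj1 (udom 0%N w)) (udom T w)).
  by rewrite mulr_ge0 ?sqr_ge0 ?(ltW L0).
by rewrite lee_fin; apply: drift_lower => //; case: (udom 0%N w).
Qed.

(* Monotonicity is not used in the first inner step, where w_{t-1} = w_0: its
   term <g(w_0) - g(z), w_0 - z> cancels the lower end of the telescoping sum. *)
Lemma phase_average : (e 0%N < +oo)%E ->
  (\sum_(t < T) \int[P]_w (V (u t.+1 w) z)%:E <= (T%:R / 2)%:E * \int[P]_w (V (u 0%N w) z)%:E)%E.
Proof.
move=> e0oo.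
have fin x : (0 <= x)%E -> (x < +oo)%E -> exists a : R, 0 <= a /\ x = a%:E.
  by case: x => //= a; rewrite lee_fin => ? _; exists a.
have [E0 [E0_ge0 E0E]] := fin _ (e_ge0 0) e0oo.
have [Q0 [Q0_ge0 Q0E]] : exists a : R, 0 <= a /\ q 0%N = a%:E.
  apply: fin => //; apply: le_lt_trans (q_le_e (leq0n _)) _.
  by rewrite E0E -EFinM ltry.
have Q0E0 : Q0 <= 2 * E0.
  by have := q_le_e (leq0n _); rewrite E0E Q0E -EFinM lee_fin.
(* The expectations are extended reals. Nonnegative ones whose weighted sum has a real bound are
   real, which opens the way to linear arithmetic. *)
have fin3 (x y w : \bar R) c c' (b : R) : 0 < c -> 0 < c' ->
    (0 <= x)%E -> (0 <= y)%E -> (0 <= w)%E ->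
    (c%:E * x + c'%:E * y + w <= b%:E)%E -> exists x' y' w' : R,
    [/\ x = x'%:E, y = y'%:E, w = w'%:E, 0 <= y' & c * x' + c' * y' + w' <= b].
  move=> c0 c'0 x0 y0 w_ge0 le_b.
  have cx : (0 <= c%:E * x)%E by rewrite mule_ge0// lee_fin ltW.
  have cy : (0 <= c'%:E * y)%E by rewrite mule_ge0// lee_fin ltW.
  have [cx' [_ cxE]] : exists a : R, 0 <= a /\ (c%:E * x)%E = a%:E.
    apply: fin => //; apply: le_lt_trans (ltry b); apply: le_trans le_b.
    by rewrite -addeA leeDl// adde_ge0.
  have [cy' [_ cyE]] : exists a : R, 0 <= a /\ (c'%:E * y)%E = a%:E.
    apply: fin => //; apply: le_lt_trans (ltry b); apply: le_trans le_b.
    by rewrite addeAC leeDr// adde_ge0.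
  have [w' [_ wE]] : exists a : R, 0 <= a /\ w = a%:E.
    apply: fin => //; apply: le_lt_trans (ltry b); apply: le_trans le_b.
    by rewrite leeDr// adde_ge0.
  have [x' xE] : exists x' : R, x = x'%:E.
    by case: x x0 cxE {cx le_b} => [x'|_|//]; [exists x'|rewrite gt0_muley ?lte_fin].
  have [y' yE] : exists y' : R, y = y'%:E.
    by case: y y0 cyE {cy le_b} => [y'|_|//]; [exists y'|rewrite gt0_muley ?lte_fin].
  exists x', y', w'; split=> //; first by rewrite yE lee_fin in y0.
  by move: le_b; rewrite xE yE wE -!EFinM -!EFinD lee_fin.
have a20 : 0 < alpha / 2 by rewrite divr_gt0.
(* Of the (alpha / 2) [q t.+1] gained in a step, alpha / 8 is kept to pay for the noise of the next
   one. After [t.+1] steps only [t] charges of (alpha / 8) [Q0] have accrued, as the first step has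
   no noise term. *)
have ind t : (t < T)%N -> exists S Qt Ht : R,
   [/\ (\sum_(s < t.+1) e s.+1 = S%:E)%E, q t.+1 = Qt%:E, h t.+1 = Ht%:E, 0 <= Qt &
     alpha * S + alpha / 8 * Qt + Ht <= eta^-1 * E0 + L * D ^+ 2 + t%:R * (alpha / 8 * Q0)].
  elim: t => [|t IH] tT.
    have := phase_step tT; rewrite e0E E0E -EFinM -EFinD.
    move=> /(fin3 _ _ _ _ _ _ a0 a20 (e_ge0 _) (q_ge0 _) (h_ge0 _)).
    move=> [x [y [w [xE yE wE y0 xyw]]]]; exists x, y, w; split=> //.
      by rewrite big_ord1.
    by have := mulr_ge0 (ltW a0) y0; lra.
  have [S [Qt [Ht [SE QE HE Q0' IHle]]]] := IH (ltnW tT).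
  have := le_trans (phase_step tT) (etE (t := t.+1) tT).
  rewrite Q0E QE HE -!EFinM -!EFinD.
  move=> /(fin3 _ _ _ _ _ _ a0 a20 (e_ge0 _) (q_ge0 _) (h_ge0 _)).
  move=> [x [y [w [xE yE wE y0 xyw]]]]; exists (S + x), y, w; split=> //.
    by rewrite big_ord_recr/= SE xE.
  move: IHle xyw (mulr_ge0 (ltW a0) y0); rewrite -(natr1 t).
  by move: (t%:R : R) => t'; lra.
have TE : T = T.-1.+1 by rewrite prednK.
have [|S [QT [HT [SE QE HE QT0 le_S]]]] := ind T.-1; first by rewrite prednK.
rewrite -TE in SE QE HE.
rewrite -/(e 0%N) E0E -EFinM.
rewrite (_ : (\sum_(t < T) _)%E = S%:E); last by rewrite -SE.
have := hT_lower; rewrite Q0E HE -EFinM -EFinD !lee_fin => lowH.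
rewrite -(ler_pM2l a0).
have T1 : T%:R = T.-1%:R + 1 :> R by rewrite natr1 -TE.
(* Since [Q0 <= 2 * E0], the T - 1 charges and the (alpha / 16) [Q0] of [hT_lower] total at most
   (alpha T / 4) [E0]. The initial term [E0] / eta takes another alpha T / 4. *)
have etaT : eta^-1 <= alpha * T%:R / 4.
  move: hT; rewrite ler_pdivrMr ?mulr_gt0// => hT'.
  rewrite -(ler_pM2l e0) divff ?gt_eqF//; lra.
have := ler_wpM2r E0_ge0 etaT.
have := ler_wpM2l (ltW a0) Q0E0.
have T10 : 0 <= T.-1%:R :> R by [].
have := ler_wpM2l T10 (ler_wpM2l (ltW a0) Q0E0).
rewrite T1; move: le_S lowH.
have := mulr_ge0 (ltW a0) QT0; have := mulr_ge0 (ltW a0) E0_ge0.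
move: (T.-1%:R : R) => t.
lra.
Qed.
End OneStep.

(** * The restarted method *)

Section SigmaOf.
Context {dO : measure_display} {Omega : measurableType dO} {I : Type}.
Variable F : I -> set_system Omega.

(** [Omega] with the sigma-algebra of the sources in [J]: to depend only on these sources is
    expressed as measurability on this space. *)
Definition sigma_space (J : set I) := g_sigma_algebraType (\bigcup_(i in J) F i).

Context {d : measure_display} {T : measurableType d}.

Lemma sigma_space_measurable_subset (J J' : set I) (X : Omega -> T) : J `<=` J' ->
  measurable_fun (setT : set (sigma_space J)) X ->
  measurable_fun (setT : set (sigma_space J')) X.
Proof.
move=> JJ' mX _ A mA; have := mX measurableT A mA.
apply: smallest_sub; first exact: smallest_sigma_algebra.
by move=> C [i Ji FC]; apply: sub_sigma_algebra; exists i => //; exact: JJ'.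
Qed.

Lemma sigma_space_measurable (J : set I) (X : Omega -> T) :
  (forall i, J i -> F i `<=` measurable) ->
  measurable_fun (setT : set (sigma_space J)) X -> measurable_fun setT X.
Proof.
move=> Fm mX _ A mA; have := mX measurableT A mA.
apply: smallest_sub; first exact: sigma_algebra_measurable.
by move=> C [i Ji FC]; exact: (Fm i).
Qed.

Lemma generator_measurable (J : set I) (X : Omega -> T) i : J i ->
  preimage_set_system setT X measurable `<=` F i ->
  measurable_fun (setT : set (sigma_space J)) X.
Proof.
move=> Ji XF _ A mA; apply: sub_sigma_algebra; exists i => //.
by apply: XF; exists A.
Qed.

End SigmaOf.

Section Restart.
Context {R : realType} {k : nat} {dX : measure_display} {Xi : measurableType dX}.
Context {dO : measure_display} {Omega : measurableType dO}.
Local Notation E := 'rV[R]_k.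
Local Notation B := (borel_rV R k).
Variables (mu : probability Xi R) (P : probability Omega R) (Z : set E) (nrm r : E -> R)
  (g : E -> E) (gt : E -> E -> Xi -> E) (L D alpha eta : R) (gr Q : E -> E) (w0 z : E).
Hypotheses (cZ : compact Z) (hr : distance_generating Z nrm r) (nrmP : is_norm nrm)
  (L0 : 0 < L) (gtm : stochastic_estimator Z gt)
  (gtc : forall z0, Z z0 -> centered mu Z nrm g gt L z0)
  (gmono : monotone_on Z g) (gcont : {within Z, continuous g})
  (hD : forall z z', Z z -> Z z' -> nrm (z - z') <= D)
  (a0 : 0 < alpha) (e0 : 0 < eta)
  (grP : gradient_selection Z r gr)
  (grm : measurable_fun (dom_subdiff Z r : set B) (gr : B -> B))
  (QP : forall s, Z (Q s) /\ subdiff Z r (Q s) s)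
  (Qc : continuous Q).

Local Notation dom := (dom_subdiff Z r).
Local Notation V := (breg r gr).
Local Notation upd := (update Z r gt alpha eta gr Q w0).

Hypotheses (domw0 : dom w0) (domz : dom z)
  (zP : forall u, Z u -> pairing (g z) (z - u) <= alpha * (V w0 u - V z u - V w0 z)).

Variables (T N : nat) (xi : nat -> nat -> Omega -> Xi) (That : nat -> Omega -> nat)
  (w : nat -> nat -> Omega -> E) (what : nat -> Omega -> E).
Hypotheses (fresh : fresh_randomness P mu T N xi That)
  (smd : restarted_mirror_descent Z r gt alpha eta N xi That w0 w what)
  (etaE : eta = alpha / (8 * L ^+ 2)) (T0 : (0 < T)%N)
  (hT : 4 / (eta * alpha) <= T%:R).

(** The phase continued beyond its random length, where [w] is unconstrained. Averaging over the
    length needs every iterate up to [T], defined without reference to that length; up to it,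
    uniqueness of the mirror step gives agreement with [w]. *)
Fixpoint iterate nu t omega : E :=
  if t is t'.+1 then upd (what nu.-1 omega, iterate nu t' omega, xi nu t omega)
  else what nu.-1 omega.

Lemma iterate_dom nu t omega : dom (what nu.-1 omega) -> dom (iterate nu t omega).
Proof. by case: t => [|t] //= _; exact: (conj_grad_dom QP). Qed.

Lemma iterateE nu t omega : (1 <= nu <= N)%N -> dom (what nu.-1 omega) ->
  (t <= That nu omega)%N -> iterate nu t omega = w nu t omega.
Proof.
move=> nuN dW; have [_ w_0 w_S _ _] := smd.
elim: t => [|t IH] tT; first by rewrite /= w_0.
have dit := iterate_dom t dW.
rewrite [LHS]/= /update /= !retract_id// IH; last exact: ltnW.
apply/esym/(mirror_step_argmin hr nrmP grP QP a0 e0 domw0).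
  by rewrite -IH// ltnW.
by have := w_S nu omega t.+1 nuN; rewrite /= tT; exact.
Qed.

Lemma what_dom nu omega : (nu <= N)%N -> dom (what nu omega).
Proof.
have [what0 _ _ whatS _] := smd; have [_ ThatP _] := fresh.
elim: nu => [|nu IH] nuN; first by rewrite what0.
have nuN' : (1 <= nu.+1 <= N)%N by rewrite nuN.
have dW := IH (ltnW nuN).
by rewrite whatS// -iterateE//; exact: iterate_dom.
Qed.

Lemma whatE nu omega : (1 <= nu <= N)%N ->
  what nu omega = iterate nu (That nu omega) omega.
Proof.
move=> nuN; have [_ _ _ whatS _] := smd.
rewrite whatS// iterateE//; apply: what_dom.
by case/andP: nuN => _; apply: leq_trans; exact: leq_pred.
Qed.

Let idx : choiceType := ((nat * nat) + nat)%type.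

Definition seed_sigma (i : (nat * nat) + nat) : set_system Omega :=
  match i with
  | inl (nu, t) => preimage_set_system setT (xi nu t) measurable
  | inr nu => preimage_set_system setT (That nu) measurable
  end.

Let indices : set idx := [set i |
  match i with
  | inl (nu, t) => (1 <= nu <= N)%N && (1 <= t <= T)%N
  | inr nu => (1 <= nu <= N)%N
  end].

(** What has been drawn by step [t] of phase [nu], without the length of phase [nu] itself: that
    length is thus independent of all the iterates of its phase. *)
Let past nu t : set idx := [set i | indices i /\
  match i with
  | inl (nu', s) => ((nu' < nu) || ((nu' == nu) && (s <= t)))%N
  | inr nu' => (nu' < nu)%N
  end].

Let seed_measurable i : indices i -> seed_sigma i `<=` measurable.
Proof.
have [xiP ThatP _] := fresh.
case: i => [[nu t]|nu] /=.
  move=> /andP[nuN tT] _ [A mA <-].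
  by have [mxi _] := xiP _ _ nuN tT; exact: mxi.
by move=> nuN _ [A mA <-]; have [mTh _ _] := ThatP _ nuN; exact: mTh.
Qed.

Let past_measurable {d} {T' : measurableType d} (X : Omega -> T') nu t :
  measurable_fun (setT : set (sigma_space seed_sigma (past nu t))) X ->
  measurable_fun setT X.
Proof. by apply: sigma_space_measurable => i [/seed_measurable]. Qed.

Let past_independent {d} {T' : measurableType d} (X : Omega -> T') nu t j A C :
  measurable_fun (setT : set (sigma_space seed_sigma (past nu t))) X ->
  indices j -> ~ past nu t j -> measurable A -> seed_sigma j C ->
  P (X @^-1` A `&` C) = (P (X @^-1` A) * P C)%E.
Proof.
move=> mX jI njp mA FC; have [_ _ indep] := fresh.
apply: (mutually_independent_sigma indep (J := past nu t) (j := j)) => //.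
- move=> i _; split.
    case: i => [[nu' s]|nu'] /= _ _ [A1 mA1 <-] [A2 mA2 <-]; rewrite -setIA;
      rewrite setTI setTI -preimage_setI.
      by exists (A1 `&` A2); [exact: measurableI|rewrite setTI].
    by exists (A1 `&` A2); [exact: measurableI|rewrite setTI].
  by case: i => [[nu' s]|nu'] /=; exists setT => //; rewrite preimage_setT setTI.
- by move=> i [].
- by have := mX measurableT A mA; rewrite setTI.
Qed.

Lemma past_iterate_measurable nu : (1 <= nu <= N)%N ->
  measurable_fun (setT : set (sigma_space seed_sigma (past nu 0))) (what nu.-1 : Omega -> B) ->
  forall t, (t <= T)%N ->
  measurable_fun (setT : set (sigma_space seed_sigma (past nu t))) (iterate nu t : Omega -> B).
Proof.
move=> nuN m0; elim=> [|t IH] tT; first exact: m0.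
have sub s s' : (s <= s')%N -> past nu s `<=` past nu s'.
  move=> ss' [[nu' l]|nu'] [iI h]; split=> //=.
  by case/orP: h => [->//|/andP[-> /leq_trans]]; rewrite orbC => -> .
have -> : iterate nu t.+1 = upd \o (fun omega => (what nu.-1 omega : B, iterate nu t omega : B, xi nu t.+1 omega)).
  by [].
have mU := update_measurable alpha eta cZ hr gtm grm Qc domw0.
apply: (measurableT_comp mU).
apply: measurable_fun_pair.
  apply: measurable_fun_pair.
    by apply: sigma_space_measurable_subset m0; exact: sub.
  by apply: sigma_space_measurable_subset (IH (ltnW tT)); exact: sub.
apply: (@generator_measurable _ _ _ _ _ _ _ _ (inl (nu, t.+1))) => //.
by split; rewrite /= ?nuN ?tT// eqxx leqnn orbT.
Qed.

(** Measurability on [Omega] says nothing about independence from later seeds; this refinement does.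
    Events are split by the value of the random length, which belongs to the past of the next
    phase. *)
Lemma past_what_measurable nu : (nu <= N)%N ->
  measurable_fun (setT : set (sigma_space seed_sigma (past nu.+1 0))) (what nu : Omega -> B).
Proof.
elim: nu => [|nu IH] nuN.
  have [what0 _ _ _ _] := smd.
  by rewrite (_ : what 0%N = cst w0); [exact: measurable_cst|exact/funext].
have nuN' : (1 <= nu.+1 <= N)%N by [].
have mit := past_iterate_measurable nuN' (IH (ltnW nuN)).
have [_ /(_ _ nuN')[_ ThatT _] _] := fresh.
have -> : what nu.+1 = fun omega => iterate nu.+1 (That nu.+1 omega) omega.
  by apply/funext => omega; exact: whatE.
move=> _ A mA; rewrite setTI.
rewrite (_ : _ @^-1` _ = \bigcup_t (if (t <= T)%N then
   (iterate nu.+1 t @^-1` A) `&` (That nu.+1 @^-1` [set t]) else set0)); last first.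
  apply/seteqP; split=> omega.
    move=> /= Ao; exists (That nu.+1 omega) => //.
    by have /andP[_ ->] := ThatT omega.
  move=> [t _]; case: ifP => // _ [] /= + tE.
  by rewrite -tE.
apply: (@bigcupT_measurable _ (sigma_space seed_sigma (past nu.+2 0))) => t.
case: ifPn => // tT.
have mTh : measurable_fun (setT : set (sigma_space seed_sigma (past nu.+2 0))) (That nu.+1).
  apply: (@generator_measurable _ _ _ _ _ _ _ _ (inr nu.+1)) => //.
apply: (@measurableI _ (sigma_space seed_sigma (past nu.+2 0))).
  rewrite -[X in measurable X]setTI.
  apply: (sigma_space_measurable_subset _ (mit t tT)) => // i [iI h]; split=> //.
  move: i h iI => [[nu' s]|nu'] /=; last by move=> h _; rewrite ltnS ltnW.
  by case/orP => [h _|/andP[/eqP -> _ _]]; rewrite ltnS ?leqnn// ltnW.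
rewrite -[X in measurable X]setTI; exact: mTh.
Qed.

Let V_iterate_measurable nu t : (1 <= nu <= N)%N -> (t <= T)%N ->
  measurable_fun setT (fun omega => V (iterate nu t omega) z).
Proof.
move=> nuN tT; have nuN1 : (nu.-1 <= N)%N.
  by case/andP: nuN => _; apply: leq_trans; exact: leq_pred.
have mW := past_what_measurable nuN1; rewrite prednK in mW; last by case/andP: nuN.
have mit := past_measurable (past_iterate_measurable nuN mW tT).
have -> : (fun omega => V (iterate nu t omega) z) =
    (fun v : B => V (retract Z r w0 v) z) \o iterate nu t.
  by apply/funext => omega /=; rewrite retract_id//; apply: iterate_dom; exact: what_dom.
exact: (measurableT_comp (breg_retract_measurable z cZ hr grm domw0) mit).
Qed.

Lemma breg_what_measurable nu : (nu <= N)%N ->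
  measurable_fun setT (fun omega => V (what nu omega) z).
Proof.
move=> nuN; have [_ _ _ _ /(_ _ nuN) mwhat] := smd.
have -> : (fun omega => V (what nu omega) z) =
    (fun v : B => V (retract Z r w0 v) z) \o what nu.
  by apply/funext => omega /=; rewrite retract_id//; exact: what_dom.
exact: (measurableT_comp (breg_retract_measurable z cZ hr grm domw0) mwhat).
Qed.

(** Decompose by the value of [That nu]: each indicator is independent of the iterate it multiplies
    and has probability 1 / T. *)
Lemma random_length_average nu : (1 <= nu <= N)%N ->
  (\int[P]_omega (V (what nu omega) z)%:E =
   (T%:R^-1)%:E * \sum_(t < T) \int[P]_omega (V (iterate nu t.+1 omega) z)%:E)%E.
Proof.
move=> nuN; have [_ /(_ _ nuN)[mTh ThatT ThatP] _] := fresh.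
have nuN1 : (nu.-1 <= N)%N by case/andP: nuN => _; apply: leq_trans; exact: leq_pred.
have mW := past_what_measurable nuN1; rewrite prednK in mW; last by case/andP: nuN.
have Vit_ge0 t omega : 0 <= V (iterate nu t omega) z.
  by apply: (breg_ge0 hr grP _ (proj1 domz)); apply: iterate_dom; exact: what_dom.
transitivity (\int[P]_omega (\sum_(t < T)
    (\1_[set t.+1] (That nu omega) * V (iterate nu t.+1 omega) z)%:E))%E.
  apply: eq_integral => omega _; rewrite sumEFin whatE//; congr (_%:E).
  have /andP[Th1 ThT] := ThatT omega.
  have ltT : ((That nu omega).-1 < T)%N by rewrite prednK.
  rewrite (bigD1 (Ordinal ltT))// -[nat_of_ord (Ordinal ltT)]/((That nu omega).-1) prednK//.
  rewrite indicE mem_set// mul1r big1 /= ?addr0// => i ne.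
  rewrite indicE memNset ?mul0r// => /= Ti; move: ne; rewrite -val_eqE/= Ti/=.
  by rewrite eqxx.
rewrite ge0_integral_sum//; first last.
- by move=> t omega _; rewrite lee_fin mulr_ge0.
- move=> t; apply/measurable_EFinP; apply: measurable_funM; last exact: V_iterate_measurable.
  by apply: (measurableT_comp (f := \1_[set t.+1] : nat -> R)).
rewrite ge0_sume_distrr; last first.
  by move=> t _; apply: integral_ge0 => omega _; rewrite lee_fin.
apply: eq_bigr => t _.
pose Th : {mfun Omega >-> nat} := HB.pack (That nu) (isMeasurableFun.Build _ _ _ _ _ mTh).
pose f (p : B * nat) := (\1_[set t.+1] p.2 * V (retract Z r w0 p.1) z)%:E.
have mit := past_iterate_measurable nuN mW (ltn_ord t).
have ret omega : retract Z r w0 (iterate nu t.+1 omega) = iterate nu t.+1 omega.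
  by rewrite retract_id//; apply: iterate_dom; exact: what_dom.
have f0 p : (0 <= f p)%E.
  rewrite lee_fin mulr_ge0// (breg_ge0 hr grP)//; last by case: domz.
  exact: (retract_dom domw0).
have mf : measurable_fun setT f.
  apply/measurable_EFinP; apply: measurable_funM.
    by apply: (measurableT_comp (f := \1_[set t.+1] : nat -> R)).
  apply: (measurableT_comp (f := fun v : B => V (retract Z r w0 v) z)) => //.
  exact: (breg_retract_measurable z cZ hr grm domw0).
have indep (A : set B) (C : set nat) : measurable A -> measurable C ->
    P (iterate nu t.+1 @^-1` A `&` That nu @^-1` C) =
    (P (iterate nu t.+1 @^-1` A) * P (That nu @^-1` C))%E.
  move=> mA mC; apply: (past_independent (j := inr nu) mit) => //.
    by case; rewrite /= ltnn.
  by exists C => //; rewrite setTI.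
transitivity (\int[P]_omega f (iterate nu t.+1 omega, That nu omega))%E.
  by apply: eq_integral => omega _; rewrite /f /= ret.
rewrite (@independent_integral _ _ _ P _ _ _ _ (distribution P Th)
  (iterate nu t.+1 : Omega -> B) (That nu) f (past_measurable mit) mTh (fun A _ => erefl) indep mf f0).
have inner v : (\int[distribution P Th]_n f (v, n) =
    (T%:R^-1)%:E * (V (retract Z r w0 v) z)%:E)%E.
  transitivity (\int[distribution P Th]_n
     ((V (retract Z r w0 v) z)%:E * (\1_[set t.+1] n)%:E))%E.
    by apply: eq_integral => n _; rewrite /f /= EFinM muleC.
  have cV : 0 <= V (retract Z r w0 v) z.
    by rewrite (breg_ge0 hr grP)//; [exact: (retract_dom domw0)|case: domz].
  have m1 : measurable_fun setT (fun n => (\1_[set t.+1] n)%:E : \bar R).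
    exact/measurable_EFinP.
  rewrite ge0_integralZl_EFin//.
  rewrite integral_indic// setIT muleC; congr (_ * _)%E.
  by apply: (ThatP t.+1); rewrite /= ltn_ord.
transitivity (\int[P]_omega ((T%:R^-1)%:E * (V (iterate nu t.+1 omega) z)%:E))%E.
  by apply: eq_integral => omega _; rewrite inner ret.
have mVt : measurable_fun setT (fun omega => (V (iterate nu t.+1 omega) z)%:E).
  by apply/measurable_EFinP; exact: V_iterate_measurable.
by rewrite ge0_integralZl_EFin// => omega _; rewrite lee_fin.
Qed.

Lemma phase_halving nu : (1 <= nu <= N)%N ->
  (\int[P]_omega (V (what nu.-1 omega) z)%:E < +oo)%E ->
  (\int[P]_omega (V (what nu omega) z)%:E <=
   (2^-1)%:E * \int[P]_omega (V (what nu.-1 omega) z)%:E)%E.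
Proof.
move=> nuN Woo; rewrite random_length_average//.
have nuN1 : (nu.-1 <= N)%N by case/andP: nuN => _; apply: leq_trans; exact: leq_pred.
have mW := past_what_measurable nuN1; rewrite prednK in mW; last by case/andP: nuN.
have mit := past_iterate_measurable nuN mW.
have [xiP _ _] := fresh.
have T0R : 0 < T%:R :> R by rewrite ltr0n.
have avg : (\sum_(t < T) \int[P]_omega (V (iterate nu t.+1 omega) z)%:E <=
    (T%:R / 2)%:E * \int[P]_omega (V (iterate nu 0 omega) z)%:E)%E.
  (* [phase_average] numbers the seeds from 0 and a phase from 1. The set [past nu t] stops just
     before [xi nu t.+1], the seed of the step that starts at [iterate nu t]. *)
  apply: (phase_average cZ hr nrmP L0 gtm gtc gmono hD a0 e0 grP grm QP Qc domw0 domz zP gcont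
     (xi := fun t => xi nu t.+1) _ _ _ _ _ _ etaE T0 hT) => //.
  - by move=> t omega; apply: iterate_dom; exact: what_dom.
  - by move=> t tT; exact: past_measurable (mit t tT).
  - by move=> t tT; have [] := xiP nu t.+1 nuN.
  - by move=> t A tT mA; have [_] := xiP nu t.+1 nuN tT; exact.
  - move=> t A C tT mA mC; apply: (past_independent (nu := nu) (t := t) (j := inl (nu, t.+1))) => //.
    + apply: measurable_fun_pair; last exact: mit (ltnW tT).
      by apply: sigma_space_measurable_subset (mit 0%N _) => // -[[nu' l]|nu'] [iI h]; split=> //=;
        case/orP: h => [->//|/andP[->]]; rewrite leqn0 => /eqP ->; rewrite orbT.
    + by rewrite /= nuN tT.
    + by move=> [_]; rewrite /= ltnn eqxx ltnn.
    + by exists C => //; rewrite setTI.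
apply: (@le_trans _ _ ((T%:R^-1)%:E * ((T%:R / 2)%:E * \int[P]_omega (V (iterate nu 0 omega) z)%:E))%E).
  by rewrite lee_pmul2l// lte_fin invr_gt0.
by rewrite muleA -EFinM mulrA mulVf ?gt_eqF// mul1r.
Qed.

Lemma restart_bound nu : (nu <= N)%N ->
  (\int[P]_omega (V (what nu omega) z)%:E <= (2^-1 ^+ nu * V w0 z)%:E)%E.
Proof.
elim: nu => [|nu IH] nuN.
  have [what0 _ _ _ _] := smd.
  rewrite expr0 mul1r (eq_integral (fun=> (V w0 z)%:E)) ?probability_integral_cst//.
  by move=> omega _; rewrite what0.
have {}IH := IH (ltnW nuN).
have nuN' : (1 <= nu.+1 <= N)%N by rewrite nuN.
apply: (le_trans (@phase_halving nu.+1 nuN' (le_lt_trans IH (ltry _)))).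
by rewrite exprS -mulrA EFinM lee_pmul2l// lte_fin invr_gt0.
Qed.
End Restart.

(** * From the distance to the proximal point to the gap *)

Section Gap.
Context {R : realType} {k : nat}.
Local Notation E := 'rV[R]_k.
Variables (Z : set E) (nrm r : E -> R) (g : E -> E) (L D G alpha : R) (gr : E -> E)
  (w0 z : E).
Hypotheses (hr : distance_generating Z nrm r) (nrmP : is_norm nrm) (L0 : 0 < L)
  (a0 : 0 < alpha) (gmono : monotone_on Z g)
  (gL : forall z z', Z z -> Z z' -> dual_norm nrm (g z - g z') <= L * nrm (z - z'))
  (gG : forall z, Z z -> dual_norm nrm (g z) <= G)
  (hD : forall z z', Z z -> Z z' -> nrm (z - z') <= D)
  (grP : gradient_selection Z r gr).
Local Notation dom := (dom_subdiff Z r).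
Local Notation V := (breg r gr).
Hypotheses (domw0 : dom w0) (domz : dom z)
  (zP : forall u, Z u -> pairing (g z) (z - u) <= alpha * (V w0 u - V z u - V w0 z)).

(** Split <g x, x - u> at [z]: two parts are controlled by |x - z| through the bound on [g] and its
    Lipschitz constant, and the third, <g z, z - u>, is at most alpha V_{w0}(u) by the inequality
    that defines [z]. *)
Lemma gap_le x u : Z x -> Z u ->
  pairing (g x) (x - u) - alpha * V w0 u <= (G + L * D) * nrm (x - z).
Proof.
move=> Zx Zu; have [Zz _] := domz; have [Zw0 _] := domw0.
have h1 : pairing (g x) (x - z) <= G * nrm (x - z).
  apply: (le_trans (pairing_le_dual nrmP _ _)).
  by rewrite ler_wpM2r ?(nrm_ge0 nrmP)// gG.
have h2 : pairing (g x - g z) (z - u) <= L * nrm (x - z) * D.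
  apply: (le_trans (pairing_le_dual nrmP _ _)).
  apply: ler_pM; rewrite ?(dual_ge0 nrmP) ?(nrm_ge0 nrmP)//; first exact: gL.
  exact: hD.
have h3 := zP Zu.
have h4 := mulr_ge0 (ltW a0) (breg_ge0 hr grP domz Zu).
have h5 := mulr_ge0 (ltW a0) (breg_ge0 hr grP domw0 Zz).
have -> : pairing (g x) (x - u) =
    pairing (g x) (x - z) + pairing (g x - g z) (z - u) + pairing (g z) (z - u).
  by rewrite !pairingE; ring.
lra.
Qed.

(** The inequality for [z] at u = w0 gives alpha V_{w0}(z) <= G n - alpha n^2 / 2 with n = |w0 - z|;
    maximise over [n]. *)
Lemma prox_breg_le : V w0 z <= G ^+ 2 / (2 * alpha ^+ 2).
Proof.
have [Zz _] := domz; have [Zw0 _] := domw0.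
have a20 : 0 < 2 * alpha by rewrite mulr_gt0.
rewrite -(ler_pM2l a0) -(ler_pM2r a20).
have -> : alpha * (G ^+ 2 / (2 * alpha ^+ 2)) * (2 * alpha) = G ^+ 2.
  by field; rewrite gt_eqF.
have := zP Zw0; rewrite breg_self.
have := ler_wpM2l (ltW a0) (breg_ge hr grP domz Zw0).
have : pairing (g z) (w0 - z) <= G * nrm (w0 - z).
  apply: (le_trans (pairing_le_dual nrmP _ _)).
  by rewrite ler_wpM2r ?(nrm_ge0 nrmP)// gG.
rewrite -[z - w0]opprB pairingNr; move: (pairing _ _) (nrm _) => p n h1 h2 h3.
have h : alpha * V w0 z <= G * n - alpha * (n ^+ 2 / 2) by lra.
have := sqr_ge0 (alpha * n - G); have := ler_wpM2r (ltW a20) h.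
rewrite !expr2; lra.
Qed.

(** A linearised square root: it bounds the expected distance by the expected divergence without
    Jensen, with [c] free to be tuned. *)
Lemma nrm_le_breg x c : dom x -> 0 < c -> nrm (x - z) <= c^-1 * V x z + c / 2.
Proof.
move=> dx c0; have [Zz _] := domz.
have := breg_ge hr grP dx Zz; rewrite (nrm_distC nrmP z).
have c1 : 0 < c^-1 by rewrite invr_gt0.
move/(ler_wpM2l (ltW c1)); have := mulr_ge0 (ltW c1) (sqr_ge0 (nrm (x - z) - c)).
move: (nrm _) => n; rewrite sqrrB.
have -> : c^-1 * (n ^+ 2 - n * c *+ 2 + c ^+ 2) = c^-1 * n ^+ 2 - 2 * n + c.
  by field; rewrite gt_eqF.
lra.
Qed.

End Gap.

(** * The number of phases, the product domain and the oracle inequality *)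

Lemma sqr_le_pow2 (R : realType) (q : R) (N : nat) : 0 < q ->
  1 + 2 * (ln q / ln 2) <= N%:R -> q ^+ 2 <= 2 ^+ N.
Proof.
move=> q0 hN.
have l2 : 0 < ln 2 :> R by rewrite ln_gt0// ltr1n.
have two0 : 0 < 2 :> R by [].
have eq2 : ln (q ^+ 2) = 2 * ln q by rewrite lnXn// mulr_natl.
have e2N : ln (2 ^+ N) = N%:R * ln 2 :> R by rewrite lnXn// mulr_natl.
have q20 : 0 < q ^+ 2 by exact: exprn_gt0.
have t20 : 0 < 2 ^+ N :> R by exact: exprn_gt0.
rewrite -(ler_ln q20 t20) eq2 e2N.
have := ler_wpM2r (ltW l2) hN; rewrite mulrDl -!mulrA mulVf ?gt_eqF//.
by move: (ln q) (ln 2) l2 (N%:R : R) => a b b0 t; lra.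
Qed.

Section SetX.
Context {R : realType} {n m : nat}.
Variables (X : set 'rV[R]_n) (Y : set 'rV[R]_m).

Lemma setXrow_convex : convex_set X -> convex_set Y -> convex_set (setXrow X Y).
Proof.
move=> cX cY _ _ t /set_mem[x Xx [y Yy <-]] /set_mem[x' Xx' [y' Yy' <-]].
apply/mem_set; rewrite convE.
exists (t%:num *: x + (1 - t%:num) *: x').
  by have := cX _ _ t (mem_set Xx) (mem_set Xx'); rewrite convE => /set_mem.
exists (t%:num *: y + (1 - t%:num) *: y').
  by have := cY _ _ t (mem_set Yy) (mem_set Yy'); rewrite convE => /set_mem.
by rewrite -add_row_mx -!scale_row_mx.
Qed.

Lemma setXrow_compact : compact X -> compact Y -> compact (setXrow X Y).
Proof.
move=> cX cY; rewrite (_ : setXrow X Y = (fun p => row_mx p.1 p.2) @` (X `*` Y)); last first.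
  apply/seteqP; split=> [_ [x Xx [y Yy <-]]|_ [[x y] [/= Xx Yy] <-]].
    by exists (x, y).
  by exists x => //; exists y.
apply: continuous_compact; last exact: compact_setX.
apply: continuous_subspaceT => p.
apply/(@cvgrPdist_lt _ 'rV[R]_(n + m) _ (nbhs p)) => e e0.
have h1 : \forall q \near p, `|p.1 - q.1| < e.
  have near_p : nbhs p.1 [set x | `|p.1 - x| < e].
    by apply/nbhs_ballP; exists e => // x; rewrite mx_norm_ball.
  exact: (@cvg_fst _ _ (nbhs p.1) (nbhs p.2) _ _ near_p).
have h2 : \forall q \near p, `|p.2 - q.2| < e.
  have near_p : nbhs p.2 [set x | `|p.2 - x| < e].
    by apply/nbhs_ballP; exists e => // x; rewrite mx_norm_ball.
  exact: (@cvg_snd _ _ (nbhs p.1) (nbhs p.2) _ _ near_p).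
apply: filterS2 h1 h2 => q q1 q2.
have : ball (row_mx p.1 p.2) e (row_mx q.1 q.2); last by rewrite mx_norm_ball.
split=> // i j; rewrite /ball/= !mxE.
case: (fintype.split j) => l.
  by apply: le_lt_trans q1; rewrite (ord1 i); have := coord_le_norm (p.1 - q.1) l; rewrite !mxE.
by apply: le_lt_trans q2; rewrite (ord1 i); have := coord_le_norm (p.2 - q.2) l; rewrite !mxE.
Qed.

End SetX.

Theorem corollary2 (R : realType) (n m : nat)
  (X : set 'rV[R]_n) (Y : set 'rV[R]_m)
  (hXconv : convex_set X) (hXcomp : compact X)
  (hYconv : convex_set Y) (hYcomp : compact Y)
  (Z : set 'rV[R]_(n + m)) (hZ : Z = setXrow X Y)
  (nrm : 'rV[R]_(n + m) -> R) (hnrm : is_norm nrm)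
  (r : 'rV[R]_(n + m) -> R) (hr : distance_generating Z nrm r)
  (alpha L : R) (halpha : 0 < alpha) (hL : 0 < L)
  (g : 'rV[R]_(n + m) -> 'rV[R]_(n + m))
  (hgcont : {within Z, continuous g}) (hgmono : monotone_on Z g)
  (dX : measure_display) (Xi : measurableType dX) (mu : probability Xi R)
  (gt : 'rV[R]_(n + m) -> 'rV[R]_(n + m) -> Xi -> 'rV[R]_(n + m))
  (hgt : stochastic_estimator Z gt)
  (hcentered : forall z0, Z z0 -> centered mu Z nrm g gt L z0)
  (G D : R) (hG0 : 0 < G) (hD0 : 0 < D)
  (hG : forall z, Z z -> dual_norm nrm (g z) <= G)
  (hD : forall z z', Z z -> Z z' -> nrm (z - z') <= D)
  (eps : R) (heps : 0 < eps)
  (eta : R) (heta : eta = alpha / (8 * L ^+ 2))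
  (T : nat) (hT : 4 / (eta * alpha) <= T%:R)
  (N : nat)
  (hN : 1 + 2 * (ln (G * (G + 2 * L * D) / (alpha * eps)) / ln 2) <= N%:R)
  (dO : measure_display) (Omega : measurableType dO) (P : probability Omega R)
  (xi : nat -> nat -> Omega -> Xi) (That : nat -> Omega -> nat)
  (hfresh : fresh_randomness P mu T N xi That)
  (O : 'rV[R]_(n + m) -> Omega -> 'rV[R]_(n + m))
  (hO : forall w0, Z w0 -> exists w what,
     restarted_mirror_descent Z r gt alpha eta N xi That w0 w what /\
     forall omega, O w0 omega = what N omega) :
  relaxed_proximal_oracle P Z r g alpha eps O.
Proof.
have cZ : compact Z by rewrite hZ; exact: setXrow_compact.
have convZ : convex_set Z by rewrite hZ; exact: setXrow_convex.
have e0 : 0 < eta by rewrite heta divr_gt0// mulr_gt0// exprn_gt0.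
have T0 : (0 < T)%N.
  rewrite -(ltr0n R); apply: lt_le_trans hT.
  by rewrite divr_gt0// mulr_gt0.
move=> w0 Zw0; have [w [what [smd OE]]] := hO _ Zw0.
have OwE : O w0 = what N by exact/funext.
have [what0 _ wS whatS mwhat] := smd.
(* Read off from the arg mins directly, because it must also hold when [r] has no subgradient at
   [w0]. *)
have Zwhat omega : Z (what N omega).
  case: (N) smd hfresh whatS wS => [|N'] _ [_ ThatP _] whatS' wS'; first by rewrite what0.
  have nuN : (1 <= N'.+1 <= N'.+1)%N by rewrite ltnS leqnn.
  have [_ /(_ omega)/andP[Th0 _] _] := ThatP _ nuN.
  by rewrite whatS'//; have [] := wS' N'.+1 omega (That N'.+1 omega) nuN; rewrite ?Th0 ?leqnn.
rewrite OwE; split=> //; first exact: mwhat.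
have [s0|s0] := pselect (subdiff Z r w0 !=set0); last first.
  apply: (@le_trans _ _ (\int[P]_omega eps%:E)%E); last by rewrite probability_integral_cst.
  apply: integral_le_ge0 => omega; first by rewrite lee_fin ltW.
  apply: ge_ereal_sup => _ [u Zu <-].
  by rewrite bregman_pinfty// gt0_muley ?lte_fin// /= leNye.
have domw0 : dom_subdiff Z r w0 by [].
have [gr grP grm] := exists_measurable_selection cZ convZ hr.
have [|Q [QP Qc]] := exists_conj_grad cZ convZ hr hnrm; first by exists w0.
have gL := centered_lipschitz cZ hnrm hL hgt hcentered.
have [z domz zP] := proximal_point_exists cZ convZ hr hnrm grP halpha (ltW hL) domw0 hgmono gL.
have bound := restart_bound cZ hr hnrm hL hgt hcentered hgmono hgcont hD halpha e0 grP grm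
  QP Qc domw0 domz zP hfresh smd heta T0 hT (leqnn N).
have whatd omega := what_dom hr hnrm halpha e0 grP QP domw0 hfresh smd omega (leqnn N).
have mV := breg_what_measurable z cZ hr hnrm halpha e0 grP grm QP domw0 hfresh smd (leqnn N).
have V0le := prox_breg_le hr hnrm halpha hG grP domw0 domz zP.
have LD0 : 0 < L * D by exact: mulr_gt0.
pose A := G + L * D; have A0 : 0 < A by rewrite addr_gt0.
(* If the expected divergence is at most c^2 / 2, the two terms of [nrm_le_breg] contribute A c / 2
   each, and A c = eps. *)
pose c := eps / A; have c0 : 0 < c by rewrite divr_gt0.
have cA : c * A = eps by rewrite divfK// gt_eqF.
(* The summand with factor 0 gives the bound the three-term shape of [ge0_integral_combine]. *)
have pointwise omega : (ereal_sup [set ((pairing (g (what N omega)) (what N omega - u))%:E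
      - alpha%:E * bregman Z r w0 u)%E | u in Z] <=
    (A / c * breg r gr (what N omega) z + 0 * breg r gr (what N omega) z + A * (c / 2))%:E)%E.
  apply: ge_ereal_sup => _ [u Zu <-].
  rewrite (bregmanE grP domw0 Zu) -EFinM -EFinB lee_fin.
  apply: (le_trans (gap_le hr hnrm halpha gL hG hD grP domw0 domz zP (Zwhat omega) Zu)).
  have := nrm_le_breg hr hnrm grP domz (whatd omega) c0.
  by move/(ler_wpM2l (ltW A0)); rewrite -/A; lra.
have V_ge0 omega : 0 <= breg r gr (what N omega) z.
  exact: (breg_ge0 hr grP (whatd omega) (proj1 domz)).
have Ac0 : 0 <= A / c by rewrite divr_ge0 ?ltW.
apply: (le_trans (integral_le_ge0 P _ pointwise)).
  move=> omega; rewrite lee_fin; apply: addr_ge0; first by rewrite mul0r addr0 mulr_ge0.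
  by apply: mulr_ge0; [exact: ltW|rewrite divr_ge0 ?(ltW c0)].
rewrite ge0_integral_combine//; last first.
  by move=> _; apply: mulr_ge0; [exact: ltW|rewrite divr_ge0 ?(ltW c0)].
rewrite mul0e adde0 probability_integral_cst.
apply: (@le_trans _ _ ((A / c)%:E * (c ^+ 2 / 2)%:E + (A * (c / 2))%:E)%E); last first.
  rewrite -EFinM -EFinD lee_fin le_eqVlt; apply/orP; left; apply/eqP.
  by rewrite -cA; field; rewrite gt_eqF.
rewrite leeD2r// lee_wpmul2l ?lee_fin//.
apply: (le_trans bound); rewrite lee_fin.
pose q := G * (G + 2 * L * D) / (alpha * eps).
have q0 : 0 < q by rewrite divr_gt0 ?mulr_gt0// addr_gt0// -mulrA mulr_gt0.
have t0 : 0 < 2 ^+ N :> R by exact: exprn_gt0.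
have q2 : q ^+ 2 <= 2 ^+ N by exact: sqr_le_pow2.
have qA : G * A / (alpha * eps) <= q.
  rewrite ler_pM2r ?invr_gt0 ?mulr_gt0// ler_pM2l// /A; lra.
rewrite exprVn mulrC ler_pdivrMr//; apply: (le_trans V0le).
(* In this form the initial divergence exceeds the target c^2 / 2 by a factor of at most q^2, which
   the [N] halvings compensate. *)
have -> : G ^+ 2 / (2 * alpha ^+ 2) = c ^+ 2 / 2 * (G * A / (alpha * eps)) ^+ 2.
  rewrite -cA; field; rewrite !gt_eqF//.
rewrite ler_wpM2l ?divr_ge0 ?sqr_ge0//; apply: le_trans q2.
by rewrite lerXn2r// nnegrE ?(ltW q0)// divr_ge0 ?mulr_ge0 ?ltW.
Qed.
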